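(* There do not exist Sobolev surfaces $\Sigma$ in the first Heisenberg group $\mathbb{H}^1$ such that $0<\mathcal{H}^2(\Sigma)<\infty$, where $\mathcal{H}^2$ is the 2-dimensional Hausdorff measure with respect to a fixed left invariant homogeneous distance of $\mathbb{H}^1$.
   Context: The Heisenberg group $\mathbb{H}^1$ is $\mathbb{R}^3$ with group operation $x\,y=x+y+(0,0,x_1y_2-x_2y_1)$. A left invariant homogeneous distance is a distance $d$ on $\mathbb{H}^1$, continuous with respect to the Euclidean topology, with $d(zx,zy)=d(x,y)$ and $d(\delta_rx,\delta_ry)=r\,d(x,y)$ for all $x,y,z\in\mathbb{H}^1$, $r>0$, where $\delta_r(x)=(rx_1,rx_2,r^2x_3)$. One such distance $d$ is fixed; $\mathcal{H}^\alpha$ is the $\alpha$-dimensional Hausdorff measure with respect to $d$. $\mathcal{H}^2_{|\cdot|}$ denotes the 2-dimensional Hausdorff measure on $\mathbb{R}^3$ with respect to the Euclidean norm $|\cdot|$. A set $S\subset\mathbb{R}^3$ is countably $\mathcal{H}^2_{|\cdot|}$-rectifiable if, up to an $\mathcal{H}^2_{|\cdot|}$-negligible set, it is contained in a countable union of images of Lipschitz maps from subsets of $\mathbb{R}^2$ to $\mathbb{R}^3$ (Euclidean metrics). A function $u\in W^{1,1}_{loc}(\Omega)$ is precisely represented if $u(x)=\lim_{r\to0^+}\frac{1}{\mathcal{L}^2(B(x,r))}\int_{B(x,r)}u\,d\mathcal{L}^2$ at every $x\in\Omega$ where this limit exists. The graph of $u:\Omega\to\mathbb{R}$, $\Omega\subset\mathbb{R}^2$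 open, means the image of one of the three maps $(s,t)\mapsto(u(s,t),s,t)$, $(s,t)\mapsto(s,u(s,t),t)$, $(s,t)\mapsto(s,t,u(s,t))$. A Sobolev surface is a countably $\mathcal{H}^2_{|\cdot|}$-rectifiable set $S\subset\mathbb{H}^1$ that equals, up to $\mathcal{H}^2_{|\cdot|}$-negligible sets, the union of a countable nonempty family of graphs of precisely represented functions of class $W^{1,1}_{loc}$ defined on nonempty open sets of $\mathbb{R}^2$. *)

(* Defs.v *)
From HB Require Import structures.
From mathcomp Require Import all_boot all_order all_algebra.
From mathcomp Require Import all_classical all_reals all_analysis.

Set Implicit Arguments.
Unset Strict Implicit.
Unset Printing Implicit Defensive.

Import Order.TTheory GRing.Theory Num.Theory.
Import numFieldNormedType.Exports.

Local Open Scope classical_set_scope.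
Local Open Scope ring_scope.

(* The plane and space are R * R and R * R * R.  The library topology on these
   types is the product (= Euclidean) topology, but the library norm and balls
   are those of the sup norm; hence the explicit Euclidean distances below. *)

Section euclidean_distance.
Variable R : realType.

Definition edist2 (x y : R * R) : R :=
  Num.sqrt ((x.1 - y.1) ^+ 2 + (x.2 - y.2) ^+ 2).

Definition edist3 (x y : R * R * R) : R :=
  Num.sqrt ((x.1.1 - y.1.1) ^+ 2 + (x.1.2 - y.1.2) ^+ 2 + (x.2 - y.2) ^+ 2).

Definition eball2 (x : R * R) (r : R) : set (R * R) :=
  [set y | edist2 y x < r].

End euclidean_distance.

Section heisenberg.
Variable R : realType.

Definition heis_mul (x y : R * R * R) : R * R * R :=
  (x.1.1 + y.1.1, x.1.2 + y.1.2, x.2 + y.2 + (x.1.1 * y.1.2 - x.1.2 * y.1.1)).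

Definition heis_dil (r : R) (x : R * R * R) : R * R * R :=
  (r * x.1.1, r * x.1.2, r ^+ 2 * x.2).

Record homogeneous_distance (d : R * R * R -> R * R * R -> R) : Prop := {
  hdist_ge0 : forall x y, 0 <= d x y ;
  hdist_eq0 : forall x y, d x y = 0 <-> x = y ;
  hdist_sym : forall x y, d x y = d y x ;
  hdist_triangle : forall x y z, d x z <= d x y + d y z ;
  hdist_continuous :
    continuous (fun p : (R * R * R) * (R * R * R) => d p.1 p.2) ;
  hdist_left_invariant :
    forall x y z, d (heis_mul z x) (heis_mul z y) = d x y ;
  hdist_homogeneous :
    forall x y r, 0 < r -> d (heis_dil r x) (heis_dil r y) = r * d x y }.

End heisenberg.

Section hausdorff_measure.
Context {T : Type} {R : realType}.
Variable d : T -> T -> R.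
Local Open Scope ereal_scope.

(* As a supremum in \bar R, this is -oo on the empty set. *)
Definition diameter (A : set T) : \bar R :=
  ereal_sup [set (d x y)%:E | x in A & y in A].

(* Empty members of a covering are skipped in the sum, so that sequences of
   sets also account for finite coverings. *)
Definition hausdorff_premeasure (alpha delta : R) (A : set T) : \bar R :=
  ereal_inf
    [set \sum_(0 <= i <oo | E i != set0) diameter (E i) `^ alpha
      | E in [set E : nat -> set T |
                A `<=` \bigcup_i E i /\
                forall i, diameter (E i) <= delta%:E]].

(* Outer measure on all subsets of T, for alpha >= 0, without a normalizing
   constant. *)
Definition hausdorff (alpha : R) (A : set T) : \bar R :=
  ereal_sup [set hausdorff_premeasure alpha delta A
              | delta in [set delta : R | (0 < delta)%R]].

End hausdorff_measure.

Section sobolev.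
Variable R : realType.

Definition leb2 :
    {measure set (measurableTypeR R * measurableTypeR R) -> \bar R} :=
  (@lebesgue_measure R \x @lebesgue_measure R)%E.

(* Measurability in the library is Borel measurability.  A function is Lebesgue
   measurable iff it agrees almost everywhere with a Borel function; the
   distinction matters because a precisely represented function is arbitrary on
   the null set where its averages do not converge.  Library integrals
   are differences of suprema over simple functions below the positive and
   negative parts, so below they may be applied to such f directly: their
   values are those for the Borel function g. *)
Definition L1loc (D : set (R * R)) (f : R * R -> R) : Prop :=
  exists g : R * R -> R,
    [/\ measurable_fun D g,
        {ae leb2, forall x, D x -> f x = g x} &
        forall K : set (R * R), compact K -> K `<=` D ->
          leb2.-integrable K (EFin \o g)].

Fixpoint Ck (k : nat) (f : R * R -> R) : Prop :=
  if k is k'.+1 then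
    [/\ continuous f,
        (forall x, derivable f x (1, 0)) /\ (forall x, derivable f x (0, 1)),
        Ck k' (fun x => 'D_(1, 0) f x) & Ck k' (fun x => 'D_(0, 1) f x)]
  else continuous f.

Definition test_function (D : set (R * R)) (phi : R * R -> R) : Prop :=
  let supp := closure [set x | phi x != 0] in
  [/\ forall k, Ck k phi, compact supp & supp `<=` D].

Definition weak_derivative (D : set (R * R)) (v : R * R)
    (u g : R * R -> R) : Prop :=
  forall phi : R * R -> R, test_function D phi ->
    \int[leb2]_(x in D) (u x * 'D_v phi x) =
    - \int[leb2]_(x in D) (g x * phi x).

Definition W11loc (D : set (R * R)) (u : R * R -> R) : Prop :=
  L1loc D u /\
  (exists2 g1, L1loc D g1 & weak_derivative D (1, 0) u g1) /\
  (exists2 g2, L1loc D g2 & weak_derivative D (0, 1) u g2).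

Definition average (u : R * R -> R) (A : set (R * R)) : R :=
  (fine (leb2 A))^-1 * \int[leb2]_(y in A) u y.

(* u is a total function standing for a function on the open set D. *)
Definition precisely_represented (D : set (R * R)) (u : R * R -> R) : Prop :=
  forall (x : R * R) (l : R), D x ->
    average u (eball2 x r) @[r --> 0^'+] --> l -> u x = l.

Definition graph1 (D : set (R * R)) (u : R * R -> R) : set (R * R * R) :=
  [set (u p, p.1, p.2) | p in D].
Definition graph2 (D : set (R * R)) (u : R * R -> R) : set (R * R * R) :=
  [set (p.1, u p, p.2) | p in D].
Definition graph3 (D : set (R * R)) (u : R * R -> R) : set (R * R * R) :=
  [set (p.1, p.2, u p) | p in D].

Definition sobolev_graph (G : set (R * R * R)) : Prop :=
  exists (D : set (R * R)) (u : R * R -> R),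
    [/\ open D, D !=set0, W11loc D u, precisely_represented D u &
        [\/ G = graph1 D u, G = graph2 D u | G = graph3 D u]].

End sobolev.

Section surfaces.
Variable R : realType.

Definition elipschitz_on (A : set (R * R)) (f : R * R -> R * R * R) : Prop :=
  exists L : R, forall x y, A x -> A y ->
    edist3 (f x) (f y) <= L * edist2 x y.

Definition countably_rectifiable (S : set (R * R * R)) : Prop :=
  exists (A : nat -> set (R * R)) (f : nat -> R * R -> R * R * R),
    (forall i, elipschitz_on (A i) (f i)) /\
    hausdorff (@edist3 R) 2 (S `\` \bigcup_i (f i @` A i)) = 0%E.

Definition sobolev_surface (S : set (R * R * R)) : Prop :=
  countably_rectifiable S /\
  exists F : set (set (R * R * R)),
    [/\ countable F, F !=set0, (forall G, F G -> sobolev_graph G) &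
        hausdorff (@edist3 R) 2 (S `+` \bigcup_(G in F) G) = 0%E].

End surfaces.

(* Main.v *)
(* On a Sobolev surface of finite 2-dimensional measure, a covering by sets of
   d-diameter r_i <= delta with sum r_i^2 <= M is extremely thin: a set of
   diameter r meets only the lines parallel to a coordinate axis within a band
   of width O(r), and along one such line the horizontal displacement, a function
   w(s, t, u) of the graph, varies on it by O(r^2) only.  Integrating
   over the lines, the images of w have total measure O(sum r_i^3), which tends
   to 0 with delta.  So w has a null image on almost every line; since u is
   W^{1,1}, w is absolutely continuous there, hence maps null sets to null
   sets, hence is constant.  For a graph z = u(s, t) one gets
   u + s t = c(t) and u - s t = c'(s), for x = u(s, t) one gets u / s = c(t) and
   t + s u = c'(s), and similarly for y = u(s, t); in each case
   v(s, t) = c(t) and v(s, t) - t m(s) = c'(s) with m injective, which is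
   impossible (this is the non-integrability of the contact distribution). *)
Require Import Defs.
From mathcomp Require Import all_boot all_order all_algebra.
From mathcomp Require Import all_classical all_reals all_analysis.
From mathcomp Require Import measurable_realfun ring lra.

Set Implicit Arguments.
Unset Strict Implicit.
Unset Printing Implicit Defensive.

Import Order.TTheory GRing.Theory Num.Theory.
Import numFieldNormedType.Exports.

Local Open Scope classical_set_scope.
Local Open Scope ring_scope.

(** * Null sets and integrals of non-measurable functions *)

(** A single graph of the family leads to the contradiction: the symmetric difference with the union
    is null for the Euclidean 2-dimensional measure, so its projection to the parameter plane is
    Lebesgue null, and almost every point of the graph lies in the surface. The functions w come
    from the bound |y_3 - x_3 - (x_1 y_2 - x_2 y_1)| <= C d(x, y)^2, which dilations and compactness
    give for every homogeneous distance: when one parameter is frozen, the left side becomes, up to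
    a factor, a difference of two values of one function. The weak derivatives are known only
    through smooth test functions, so absolute continuity on lines is extracted from product test
    functions with explicit nonsmooth limits. The constants c(t) and c'(s) are known line by line
    and almost everywhere only, so the final impossibility is not read off pointwise but from
    integrals taken in the two orders of Fubini. The sets that occur may fail to be measurable,
    hence the repeated use of coverings and negligible sets. *)

Lemma negligible_eps d (T : measurableType d) (R : realType)
    (mu : {measure set T -> \bar R}) (S : set T) :
  (forall e : R, 0 < e -> exists A,
     [/\ measurable A, S `<=` A & (mu A <= e%:E)%E]) ->
  mu.-negligible S.
Proof.
move=> H.
have inv0 n : 0 < n.+1%:R^-1 :> R by rewrite invr_gt0.
have [A HA] := choice (fun n => H _ (inv0 n)).
exists (\bigcap_n A n); split.
- by apply: bigcapT_measurable => n; have [] := HA n.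
- apply/eqP; rewrite eq_le measure_ge0 andbT; apply/lee_addgt0Pr => /= e e0.
  rewrite add0e.
  have [n nP] : exists n, n.+1%:R^-1 < e.
    have [n hn] := ltr_add_invr (e0 : 0 < e).
    by exists n; rewrite add0r in hn.
  apply: (@le_trans _ _ (mu (A n))).
    apply: le_measure; rewrite ?inE.
    - by apply: bigcapT_measurable => k; have [] := HA k.
    - by have [] := HA n.
    - exact: bigcap_inf.
  by have [_ _ /le_trans] := HA n; apply; rewrite lee_fin ltW.
- by move=> x Sx n _; have [_ /(_ x Sx)] := HA n.
Qed.

(* The library's Lebesgue integral is a lower integral, which makes sense for
   non-measurable functions and is insensitive to null sets. *)
Section ae_integral.
Import HBNNSimple.
Context d (T : measurableType d) (R : realType).
Variable mu : {measure set T -> \bar R}.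
Local Open Scope ereal_scope.

Lemma ge0_ae_le_integralT (f g : T -> \bar R) :
  (forall x, 0 <= f x) -> (forall x, 0 <= g x) ->
  {ae mu, forall x, f x = g x} ->
  \int[mu]_x f x <= \int[mu]_x g x.
Proof.
move=> f0 g0 [N [mN N0 fgN]].
rewrite !ge0_integralTE//.
apply: ge_ereal_sup => _ /= [h hf <-].
(* Cutting the simple function [h] off on the null set keeps its integral and puts it below [g]
   everywhere. *)
pose h' : {nnsfun T >-> R} := proj_nnsfun h (measurableC mN).
have -> : sintegral mu h = sintegral mu h'.
  rewrite -!integralT_nnsfun.
  apply: ae_eq_integral => //; first exact/measurable_EFinP.
    exact/measurable_EFinP.
  exists N; split=> // x /= hx; apply: contrapT => Nx; apply: hx => _.
  by rewrite /h' /= /proj_nnsfun/= /mindic/= indicE mem_set//= mulr1.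
apply: ereal_sup_ubound; exists h' => //= x.
rewrite mindicE; case: (boolP (x \in ~` N)) => [|xN]; last by rewrite mulr0 g0.
rewrite inE/= => Nx; rewrite mulr1.
suff <- : f x = g x by exact: hf.
by apply: contrapT => fg; apply: Nx; exact: fgN.
Qed.

Lemma ae_eq_integralT (f g : T -> \bar R) :
  {ae mu, forall x, f x = g x} -> \int[mu]_x f x = \int[mu]_x g x.
Proof.
move=> fg.
have gf : {ae mu, forall x, g x = f x} by apply: filterS fg => x ->.
have le_pos (a b : T -> \bar R) : {ae mu, forall x, a x = b x} ->
    \int[mu]_x a^\+ x <= \int[mu]_x b^\+ x.
  move=> ab; apply: ge0_ae_le_integralT; [exact: funepos_ge0..|].
  by apply: filterS ab => x abx; rewrite !funeposE abx.
have le_neg (a b : T -> \bar R) : {ae mu, forall x, a x = b x} ->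
    \int[mu]_x a^\- x <= \int[mu]_x b^\- x.
  move=> ab; apply: ge0_ae_le_integralT; [exact: funeneg_ge0..|].
  by apply: filterS ab => x abx; rewrite !funenegE abx.
rewrite integralE [RHS]integralE; congr (_ - _); apply/eqP; rewrite eq_le.
  by rewrite (le_pos _ _ fg) (le_pos _ _ gf).
by rewrite (le_neg _ _ fg) (le_neg _ _ gf).
Qed.

Lemma ae_eq_RintegralT (f g : T -> R) :
  {ae mu, forall x, f x = g x} -> (\int[mu]_x f x)%R = (\int[mu]_x g x)%R.
Proof.
move=> fg; congr fine; apply: ae_eq_integralT.
by apply: filterS fg => x ->.
Qed.

End ae_integral.

(** * Absolutely continuous functions and null images *)

Lemma negligible_cover d (T : measurableType d) (R : realType)
    (mu : {measure set T -> \bar R}) (S : set T) :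
  (forall e : R, 0 < e -> exists A : nat -> set T,
     [/\ forall n, measurable (A n), S `<=` \bigcup_n A n &
         (\sum_(n <oo) mu (A n) <= e%:E)%E]) ->
  mu.-negligible S.
Proof.
move=> H; apply: negligible_eps => e /H[A [mA SA Ae]].
exists (\bigcup_n A n); split => //; first exact: bigcupT_measurable.
apply: le_trans Ae; apply: measure_sigma_subadditive => //.
exact: bigcupT_measurable.
Qed.

Lemma ge0_subset_Rintegral d (T : measurableType d) (R : realType)
    (mu : {measure set T -> \bar R}) (A B : set T) (f : T -> R) :
  measurable A -> measurable B -> (forall x, 0 <= f x) ->
  mu.-integrable B (EFin \o f) -> A `<=` B ->
  \int[mu]_(x in A) f x <= \int[mu]_(x in B) f x.
Proof.
move=> mA mB f0 fi AB.
have fiA : mu.-integrable A (EFin \o f) by exact: integrableS fi.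
rewrite -lee_fin /Rintegral !fineK; try exact: integrable_fin_num.
apply: ge0_subset_integral => //; first exact: measurable_int fi.
by move=> x _; rewrite lee_fin.
Qed.

Lemma lebesgue_measure_itvc (R : realType) (x r : R) : 0 <= r ->
  lebesgue_measure `[x - r, x + r]%classic = (2 * r)%:E.
Proof.
move=> r0; rewrite lebesgue_measure_itv/= lte_fin.
case: ifPn => [_|]; first by rewrite -EFinD; congr EFin; ring.
rewrite -leNgt => h; have -> : r = 0 by apply/eqP; rewrite eq_le r0 andbT; lra.
by rewrite mulr0.
Qed.

Section absolutely_continuous.
Variable R : realType.
Notation mu := (@lebesgue_measure R).
Implicit Types (a b : R) (h W : R -> R).

(** Absolute continuity with a density: [h] stands for the modulus of the derivative of [W], without
    mention of that derivative. *)
Definition integral_modulus a b h W := forall x y, a < x -> x <= y -> y < b ->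
  `|W y - W x| <= \int[mu]_(z in `]x, y[) h z.

(** Luzin's property N. The null set lies in an open set over which [h] has a small integral. On
    each component [J] all values of [W] are within the integral of [h] over [J] of any one of them,
    so intervals of total length twice the whole integral cover the image. *)
Lemma image_negligible a b h W (N : set R) : (forall z, 0 <= h z) ->
  mu.-integrable setT (EFin \o h) -> integral_modulus a b h W ->
  mu.-negligible N -> mu.-negligible (W @` (N `&` `]a, b[)).
Proof.
move=> h0 ih hW [N' [mN' N'0 NN']]; apply: negligible_cover => e e0.
have e20 : 0 < e / 2 by rewrite divr_gt0.
have [r [r0 hr]] := integral_normr_continuous ih e20.
have N'oo : (mu N' < +oo)%E by rewrite N'0.
have [U [oU N'U mU]] := lebesgue_regularity_outer mN' N'oo r0.
pose O := U `&` `]a, b[%classic.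
have oO : open O by apply: openI => //; exact: interval_open.
have mO : measurable O by exact: open_measurable.
have mOr : (mu O < r%:E)%E.
  apply: le_lt_trans mU; rewrite -[leRHS]adde0 -[in leRHS]N'0.
  apply: (@le_trans _ _ (mu ((U `\` N') `|` N'))).
    apply: le_measure; rewrite ?inE//.
      by apply: measurableU => //; apply: measurableD => //; exact: open_measurable.
    by move=> x [Ux _]; have [N'x|N'x] := pselect (N' x); [right|left].
  by apply: measureU2 => //; apply: measurableD => //; exact: open_measurable.
pose J := open_disjoint_itv oO.
have OE : O = \bigcup_i J i := open_disjoint_itv_bigcup oO.
have mJ i : measurable (J i).
  by apply: open_measurable; exact: open_disjoint_itv_open.
have JO i : J i `<=` O.
  by move=> t Jt; rewrite OE; exists i.
have ihJ (A : set R) : measurable A -> mu.-integrable A (EFin \o h).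
  by move=> mA; apply: integrableS ih.
pose rho i := \int[mu]_(z in J i) h z.
have rho0 i : 0 <= rho i by apply: Rintegral_ge0.
(* A component may be empty; then [x0 i] is arbitrary and [rho i] is 0, so the covering interval is
   a point. *)
have /choice[x0 hx0] i : exists x, J i !=set0 -> J i x.
  by have [[x Jx]|] := pselect (J i !=set0); [exists x|exists 0].
exists (fun i => `[W (x0 i) - rho i, W (x0 i) + rho i]%classic); split => //.
- move=> _ [z [/NN'/N'U Uz abz] <-].
  have : O z by split.
  rewrite OE => -[i _ Jz]; exists i => //=.
  have Jx := hx0 i (ex_intro _ _ Jz).
  have key x y : J i x -> J i y -> x <= y -> `|W y - W x| <= rho i.
    move=> Jx' Jy xy.
    have [_ /= /[!in_itv]/= /andP[ax _]] := JO _ _ Jx'.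
    have [_ /= /[!in_itv]/= /andP[_ yb]] := JO _ _ Jy.
    apply: le_trans (hW _ _ ax xy yb) _.
    apply: ge0_subset_Rintegral => //; [exact: mJ|exact: ihJ|].
    move=> t /=; rewrite in_itv/= => /andP[xt ty].
    by apply: (@open_disjoint_itv_is_interval _ _ oO i _ _ Jx' Jy); rewrite !ltW.
  rewrite in_itv/=.
  have : `|W z - W (x0 i)| <= rho i.
    have [xz|/ltW zx] := leP (x0 i) z; first exact: key.
    by rewrite distrC; exact: key.
  by rewrite ler_norml => /andP[? ?]; apply/andP; split; lra.
- rewrite (eq_eseriesr (g := fun i => (2%:E * \int[mu]_(z in J i) (h z)%:E)%E)).
    rewrite nneseriesZl; last by move=> i _; apply: integral_ge0 => t _; rewrite lee_fin.
    rewrite -ge0_integral_bigcup//; last 3 first.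
    + by apply: measurable_int (ihJ _ _); exact: bigcupT_measurable.
    + by move=> t _; rewrite lee_fin.
    + exact: open_disjoint_itv_trivIset.
    rewrite -OE.
    have := hr _ mO mOr.
    rewrite -lte_fin /Rintegral fineK; last first.
      exact: integrable_fin_num (integrable_norm (ihJ _ mO)).
    under eq_integral do rewrite ger0_norm//.
    move=> /ltW hO; apply: le_trans (lee_wpmul2l _ hO) _; first by rewrite lee_fin.
    by rewrite -EFinM lee_fin mulrC divfK.
  move=> i _; transitivity ((2 * rho i)%:E); first exact: lebesgue_measure_itvc.
  rewrite EFinM /rho /Rintegral fineK//.
  by apply: integrable_fin_num; [exact: mJ|apply: ihJ; exact: mJ].
Qed.

Lemma integral_modulus_continuous a b h W : (forall z, 0 <= h z) ->
  mu.-integrable setT (EFin \o h) -> integral_modulus a b h W ->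
  forall x, a < x < b -> {for x, continuous W}.
Proof.
move=> h0 ih hW x /andP[ax xb]; apply/cvgrPdist_lt => e e0.
have [r [r0 hr]] := integral_normr_continuous ih e0.
have key u v : a < u -> u <= v -> v < b -> v - u < r -> `|W v - W u| < e.
  move=> au uv vb uvr; apply: le_lt_trans (hW _ _ au uv vb) _.
  have -> : \int[mu]_(z in `]u, v[) h z = \int[mu]_(z in `]u, v[) `|h z|.
    by apply: eq_Rintegral => t _; rewrite ger0_norm.
  apply: hr => //; rewrite [ltLHS]lebesgue_measure_itv/= lte_fin.
  by case: ifP => _; rewrite -?EFinD lte_fin.
have ar : x - r < x by lra.
have rb : x < x + r by lra.
near=> y.
have ay : a < y by near: y; exact: lt_nbhsr.
have yb : y < b by near: y; exact: lt_nbhsl.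
have xry : x - r < y by near: y; exact: lt_nbhsr.
have yxr : y < x + r by near: y; exact: lt_nbhsl.
have [xy|/ltW yx] := leP x y; last by apply: key => //; lra.
by rewrite distrC; apply: key => //; lra.
Unshelve. all: by end_near. Qed.

(** By the intermediate value theorem the image contains the segment between any two of its values,
    which has positive length unless they coincide. *)
Lemma negligible_image_constant a b h W : (forall z, 0 <= h z) ->
  mu.-integrable setT (EFin \o h) -> integral_modulus a b h W ->
  mu.-negligible (W @` `]a, b[) ->
  forall x y, a < x < b -> a < y < b -> W x = W y.
Proof.
move=> h0 ih hW nW; have cW := integral_modulus_continuous h0 ih hW.
suff key x y : a < x < b -> a < y < b -> x <= y -> W x = W y.
  move=> x y abx aby; have [xy|/ltW yx] := leP x y; first exact: key.
  by apply/esym/key.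
move=> /andP[ax xb] /andP[ay yb] xy; apply: contrapT => /eqP Wxy.
have sub : `[Num.min (W x) (W y), Num.max (W x) (W y)] `<=` W @` `]a, b[.
  move=> v /=; rewrite in_itv/= => vW.
  have cWxy : {within `[x, y], continuous W}.
    apply: continuous_in_subspaceT => z; rewrite inE/= in_itv/= => /andP[xz zy].
    by apply: cW; rewrite (lt_le_trans ax)//= (le_lt_trans zy).
  have [z] := IVT xy cWxy vW; rewrite in_itv/= => /andP[xz zy] <-.
  by exists z => //=; rewrite in_itv/= (lt_le_trans ax)//= (le_lt_trans zy).
have := @negligibleS _ _ _ mu _ _ sub nW.
move/(@measure_negligible _ _ _ mu _ (measurable_itv _)); rewrite [LHS]lebesgue_measure_itv/=.
have mM : Num.min (W x) (W y) < Num.max (W x) (W y).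
  by move: Wxy; case: (ltgtP (W x) (W y)).
rewrite lte_fin mM -EFinD => -[] /eqP; rewrite subr_eq0 => /eqP E.
by rewrite E ltxx in mM.
Qed.

End absolutely_continuous.

(** * Coverings of finite 2-dimensional measure *)

Lemma hausdorff2_cover (T : Type) (R : realType) (d : T -> T -> R) (A : set T)
    (M delta : R) : (forall x y, 0 <= d x y) -> 0 < delta ->
  (hausdorff d 2 A < M%:E)%E ->
  exists (E : nat -> set T) (r : nat -> R),
    [/\ A `<=` \bigcup_i E i, forall i, 0 <= r i <= delta,
      forall i x y, E i x -> E i y -> d x y <= r i &
      (\sum_(i <oo) ((r i) ^+ 2)%:E < M%:E)%E].
Proof.
move=> d0 delta0 HM.
have : (hausdorff_premeasure d 2 delta A < M%:E)%E.
  by apply: le_lt_trans HM; apply: ereal_sup_ubound; exists delta.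
move=> /ereal_inf_lt[_ /= [E [AE dE] <-] EM].
have dE0 i : E i !=set0 -> (0 <= diameter d (E i))%E.
  move=> [x Ex]; apply: (@le_trans _ _ (d x x)%:E); first by rewrite lee_fin.
  by apply: ereal_sup_ubound; exists x => //; exists x.
have dEf i : E i !=set0 -> diameter d (E i) = (fine (diameter d (E i)))%:E.
  move=> Ei; rewrite fineK// ge0_fin_numE ?dE0//.
  exact: le_lt_trans (dE i) (ltry _).
(* An empty member has diameter [-oo]; radius 0 gives it the contribution 0, so that the sum can run
   over all indices. *)
pose r i := if E i == set0 then 0 else fine (diameter d (E i)).
exists E, r; split=> //.
- move=> i; rewrite /r; case: ifPn => [_|/set0P Ei]; first by rewrite lexx ltW.
  by rewrite -2!lee_fin -dEf// dE0//= dE.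
- move=> i x y Ex Ey; have Ei : E i !=set0 by exists x.
  rewrite /r; case: ifPn => [/eqP E0|_]; first by rewrite E0 in Ex.
  rewrite -lee_fin -dEf//.
  by apply: ereal_sup_ubound; exists x => //; exists y.
- move: EM; rewrite eseries_mkcond; congr (_ < _)%E; apply: eq_eseriesr => i _.
  rewrite /r; case: ifPn => [/set0P Ei|]; last first.
    by rewrite negbK => ->; rewrite expr0n.
  rewrite ifF; last by apply/negbTE/set0P.
  rewrite [in LHS]dEf// poweR_EFin powR_mulrn// -lee_fin -dEf//; exact: dE0.
Qed.

Lemma leb2_rect (R : realType) (A B : set R) : measurable A -> measurable B ->
  leb2 R (A `*` B) = (lebesgue_measure A * lebesgue_measure B)%E.
Proof. by move=> mA mB; exact: product_measure1E. Qed.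

(** A covering set of diameter [r] projects into a square of side [2 * r] and area [4 * r ^+ 2];
    hence the choice of [e / 4]. *)
Lemma negligible_projection (R : realType) (Z : set (R * R * R))
    (f : R * R * R -> R * R) :
  (forall x y, `|(f x).1 - (f y).1| <= edist3 x y) ->
  (forall x y, `|(f x).2 - (f y).2| <= edist3 x y) ->
  hausdorff (@edist3 R) 2 Z = 0%E ->
  (leb2 R).-negligible (f @` Z).
Proof.
move=> f1 f2 Z0; apply: negligible_cover => e e0.
have e40 : 0 < e / 4 by rewrite divr_gt0.
have HZ : (hausdorff (@edist3 R) 2 Z < (e / 4)%:E)%E by rewrite Z0 lte_fin.
have d0 (x y : R * R * R) : 0 <= edist3 x y by rewrite sqrtr_ge0.
have [E [r [ZE r0 Er sumr]]] := hausdorff2_cover d0 ltr01 HZ.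
have {}r0 i : 0 <= r i by have /andP[] := r0 i.
have /choice[p hp] i : exists p, E i !=set0 -> E i p.
  by have [[x Jx]|] := pselect (E i !=set0); [exists x|exists (0, 0, 0)].
pose I c i := `[c - r i, c + r i]%classic.
exists (fun i => I (f (p i)).1 i `*` I (f (p i)).2 i); split.
- by move=> i; apply: measurableX; exact: measurable_itv.
- move=> _ [x Zx <-]; have [i _ Ex] := ZE x Zx; exists i => //=.
  have Ep := hp i (ex_intro _ _ Ex).
  have := le_trans (f1 x (p i)) (Er _ _ _ Ex Ep).
  have := le_trans (f2 x (p i)) (Er _ _ _ Ex Ep).
  rewrite /I /= !in_itv/= !ler_norml => /andP[? ?] /andP[? ?].
  by split; apply/andP; split; lra.
- have key i : leb2 R (I (f (p i)).1 i `*` I (f (p i)).2 i) =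
      (4%:E * ((r i) ^+ 2)%:E)%E.
    rewrite leb2_rect; [|exact: measurable_itv|exact: measurable_itv].
    rewrite ![lebesgue_measure _]lebesgue_measure_itvc// -!EFinM; congr EFin; ring.
  rewrite (eq_eseriesr (fun i _ => key i)) nneseriesZl; last first.
    by move=> i _; rewrite lee_fin sqr_ge0.
  apply: le_trans (lee_wpmul2l _ (ltW sumr)) _; first by rewrite lee_fin.
  by rewrite -EFinM lee_fin mulrC divfK.
Qed.

Section slicing.
Variables (R : realType) (T : Type) (d : T -> T -> R).
Notation mu := (@lebesgue_measure R).

(* Each covering set of diameter r meets only lines y = const within a band of
   width O(r), and on each of them w oscillates by O(r^2): the images w(A_y) have
   total measure O(sum r^3), which tends to 0 with the mesh. *)
Lemma negligible_slice_image (S : set T) (A : set (R * R)) (G : R * R -> T)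
    (w : R * R -> R) (C : R) :
  (forall x y, 0 <= d x y) -> (hausdorff d 2 S < +oo)%E -> 0 <= C ->
  G @` A `<=` S ->
  (forall p q r, A p -> A q -> 0 <= r <= 1 -> d (G p) (G q) <= r ->
     `|p.2 - q.2| <= C * r /\ (p.2 = q.2 -> `|w p - w q| <= C * r ^+ 2)) ->
  {ae mu, forall y, mu.-negligible (w @` (A `&` [set p | p.2 = y]))}.
Proof.
move=> d0 Soo C0 GS Hw.
have [M HM] : exists M : R, (hausdorff d 2 S < M%:E)%E.
  move: Soo; case: (hausdorff d 2 S) => [s _| |_]; last by exists 0; rewrite ltNyr.
    by exists (s + 1); rewrite lte_fin; lra.
  by rewrite ltxx.
have M0 : 0 <= M.
  have [E [r [_ _ _ sumr]]] := hausdorff2_cover d0 ltr01 HM.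
  rewrite -lee_fin; apply: le_trans (ltW sumr).
  by apply: nneseries_ge0 => i _ _; rewrite lee_fin sqr_ge0.
have del0 n : 0 < (2 ^- n : R) by rewrite invr_gt0 exprn_gt0.
(* One covering for each mesh [2 ^- n]: the geometric decay makes the integrals below summable over
   [n]. *)
have /choice[E] n : exists E : (nat -> set T) * (nat -> R),
    [/\ S `<=` \bigcup_i E.1 i, forall i, 0 <= E.2 i <= 2 ^- n,
      forall i x y, E.1 i x -> E.1 i y -> d x y <= E.2 i &
      (\sum_(i <oo) ((E.2 i) ^+ 2)%:E < M%:E)%E].
  have [E [r HE]] := hausdorff2_cover d0 (del0 n) HM.
  by exists (E, r).
move=> /all_and4[SE rE dE sumE].
pose r n := (E n).2; pose B n i := A `&` G @^-1` (E n).1 i.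
have r0 n i : 0 <= r n i by have /andP[] := rE n i.
have r1 n i : 0 <= r n i <= 1.
  rewrite r0/=; have /andP[_ /le_trans] := rE n i; apply.
  by rewrite invf_le1 ?exprn_gt0// exprn_ege1// ler1n.
have /choice[c hc] n : exists c : nat -> R,
    forall i p, B n i p -> `|p.2 - c i| <= C * r n i.
  have /choice[c hc] i : exists c, forall p, B n i p -> `|p.2 - c| <= C * r n i.
    have [[q [Aq Eq]]|nB] := pselect (B n i !=set0); last first.
      by exists 0 => p Bp; exfalso; apply: nB; exists p.
    exists q.2 => p [Ap Ep].
    by have [] := Hw p q (r n i) Ap Aq (r1 n i) (dE n i _ _ Ep Eq).
  by exists c.
pose Iv n i := `[c n i - C * r n i, c n i + C * r n i]%classic.
(* The length of an interval that covers the image of [B n i] on the line at height [y]; it is 0 off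
   the band [Iv n i], which contains all heights met by [B n i]. *)
pose F n i (y : R) : \bar R := (2 * C * (r n i) ^+ 2 * \1_(Iv n i) y)%:E.
have F0 n i y : (0 <= F n i y)%E.
  by rewrite lee_fin !mulr_ge0// sqr_ge0.
have mF n i : measurable_fun setT (F n i).
  apply/measurable_EFinP; apply: measurable_funM; first exact: measurable_cst.
  by apply: measurable_indic; exact: measurable_itv.
pose Fs n y := (\sum_(i <oo) F n i y)%E.
have Fs0 n y : (0 <= Fs n y)%E by apply: nneseries_ge0.
have mFs n : measurable_fun setT (Fs n).
  by apply: ge0_emeasurable_sum => //.
have intF n i : (\int[mu]_y F n i y =
    ((2 * C) ^+ 2 * (r n i) * (r n i) ^+ 2)%:E)%E.
  under eq_integral do rewrite /F EFinM.
  rewrite integralZl//; last first.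
    exact: integrable_indic_itv.
  rewrite integral_indic//; last exact: measurable_itv.
  rewrite setIT [X in (_ * X)%E]lebesgue_measure_itvc; last by rewrite mulr_ge0.
  by rewrite -EFinM; congr EFin; ring.
have intFs n : (\int[mu]_y Fs n y <= (((2 * C) ^+ 2 * M) * 2 ^- n)%:E)%E.
  rewrite integral_nneseries//; last exact: mF.
  apply: (@le_trans _ _
    (\sum_(i <oo) (((2 * C) ^+ 2 * 2 ^- n)%:E * ((r n i) ^+ 2)%:E))%E).
    apply: lee_nneseries => [i _ _|i _].
      by apply: integral_ge0 => y _; exact: F0.
    rewrite intF -EFinM lee_fin ler_wpM2r ?sqr_ge0// ler_wpM2l ?sqr_ge0//.
    by have /andP[] := rE n i.
  rewrite nneseriesZl; last by move=> i _; rewrite lee_fin sqr_ge0.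
  apply: le_trans (lee_wpmul2l _ (ltW (sumE n))) _.
    by rewrite lee_fin mulr_ge0 ?sqr_ge0// ltW.
  by rewrite -EFinM lee_fin mulrAC.
(* The sum over all coverings has a finite integral, so at almost every height it is finite, and the
   total lengths [Fs n y] cannot all stay above a given [e]. *)
pose H y := (\sum_(n <oo) Fs n y)%E.
have intH : (\int[mu]_y H y < +oo)%E.
  rewrite /H integral_nneseries//.
  apply: (@le_lt_trans _ _
    (\sum_(n <oo) (((2 * C) ^+ 2 * M * 2) / (2 ^ n.+1)%:R)%:E)%E).
    apply: lee_nneseries; first by move=> m _ _; apply: integral_ge0 => y _; exact: Fs0.
    move=> m _; apply: le_trans (intFs m) _; rewrite lee_fin natrX (exprS 2 m) invfM mulrA.
    by rewrite mulfK.
  apply: le_lt_trans (epsilon_trick0 xpredT _) (ltry _).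
  by rewrite !mulr_ge0// exprn_ge0// mulr_ge0.
have mH : measurable_fun setT H by apply: ge0_emeasurable_sum.
have H0 y : (0 <= H y)%E by apply: nneseries_ge0.
have iH : mu.-integrable setT H.
  apply/integrableP; split => //.
  by under eq_integral do rewrite gee0_abs//.
have := integrable_ae (@measurableT _ _) iH; apply: filterS => y /(_ I) Hy.
have {}Hy : (H y < +oo)%E by rewrite -ge0_fin_numE.
apply: negligible_cover => e e0.
have [n Fe] : exists n, (Fs n y < e%:E)%E.
  apply: contrapT => /forallNP nF.
  have {}nF n : (e%:E <= Fs n y)%E by rewrite leNgt; apply/negP/nF.
  have hy : (fine (H y))%:E = H y by rewrite fineK// ge0_fin_numE.
  have h0 : 0 <= fine (H y) / e by apply: divr_ge0; [exact: fine_ge0|exact: ltW].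
  have := archi_boundP h0; set N := Num.bound _ => hN.
  have : ((N%:R * e)%:E <= H y)%E.
    apply: le_trans (nneseries_lim_ge N _); last by [].
    rewrite mulr_natl -[X in _ *+ X]subn0 -sumr_const_nat -sumEFin.
    by apply: lee_sum.
  by rewrite -hy lee_fin leNgt -ltr_pdivrMr// hN.
have /choice[a ha] i : exists a, forall p, B n i p -> p.2 = y -> `|w p - a| <= C * r n i ^+ 2.
  have [[q [[Aq Eq] qy]]|nB] := pselect (exists q, B n i q /\ q.2 = y); last first.
    by exists 0 => p Bp py; exfalso; apply: nB; exists p.
  exists (w q) => p [Ap Ep] py.
  have [_] := Hw p q (r n i) Ap Aq (r1 n i) (dE n i _ _ Ep Eq).
  by apply; rewrite qy.
(* Radius 0 off the band makes the length of the [i]-th interval equal to [F n i y]. *)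
pose b i := if y \in Iv n i then C * r n i ^+ 2 else 0.
have b0 i : 0 <= b i by rewrite /b; case: ifP => // _; rewrite mulr_ge0// sqr_ge0.
exists (fun i => `[a i - b i, a i + b i]%classic); split.
- by move=> i; exact: measurable_itv.
- move=> _ [p [Ap /= py] <-].
  have [i _ Ei] := SE n (G p) (GS _ (ex_intro2 _ _ p Ap erefl)).
  have Bp : B n i p by split.
  exists i => //=; rewrite in_itv/=.
  have yI : y \in Iv n i.
    rewrite inE /Iv/= in_itv/= -py.
    by have := hc n i p Bp; rewrite ler_norml => /andP[? ?]; apply/andP; split; lra.
  have := ha i p Bp py; rewrite /b yI ler_norml => /andP[? ?].
  by apply/andP; split; lra.
- apply: le_trans (ltW Fe); apply: lee_nneseries => // i _.
  rewrite [leLHS]lebesgue_measure_itvc// lee_fin indicE /b.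
  by case: ifP => _; rewrite ?mulr1 ?mulr0// mulrA.
Qed.

End slicing.

(** * Smooth step functions *)

Section smooth.
Variable R : realType.
Implicit Types (f g : R -> R) (k m n : nat).

(** Derivatives enter as witnesses, so that closure under sums, products and inverses is a plain
    induction on [k]. *)
Fixpoint smoothk k f : Prop :=
  if k is k'.+1 then
    exists2 f' : R -> R, (forall x : R, is_derive x 1 f (f' x)) & smoothk k' f'
  else continuous f.

Definition smooth f := forall k, smoothk k f.

Lemma is_derive_continuous f f' :
  (forall x : R, is_derive x 1 f (f' x)) -> continuous f.
Proof.
move=> df x; apply: differentiable_continuous; apply/derivable1_diffP.
by case: (df x).
Qed.

Lemma is_derive_unique f f1 f2 : (forall x : R, is_derive x 1 f (f1 x)) ->
  (forall x : R, is_derive x 1 f (f2 x)) -> f1 = f2.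
Proof. by move=> d1 d2; apply/funext => x; case: (d1 x) => _ <-; case: (d2 x). Qed.

Lemma smoothkS k f : smoothk k.+1 f -> smoothk k f.
Proof.
elim: k f => [f [f' df _]|k IH f [f' df sf']]; first exact: is_derive_continuous df.
by exists f' => //; exact: IH.
Qed.

Lemma smooth_derive f f' : (forall x : R, is_derive x 1 f (f' x)) ->
  smooth f -> smooth f'.
Proof. by move=> df sf k; have [f1 df1 /=] := sf k.+1; rewrite (is_derive_unique df df1). Qed.

Lemma smooth_is_derive f : smooth f ->
  exists2 f', (forall x : R, is_derive x 1 f (f' x)) & smooth f'.
Proof.
move=> sf; have [f' df _] := sf 1%N; exists f' => //; exact: smooth_derive sf.
Qed.

Lemma smooth_continuous f : smooth f -> continuous f.
Proof. exact: (fun sf => sf 0%N). Qed.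

Lemma smoothk_cst k (c : R) : smoothk k (fun=> c).
Proof.
elim: k c => [c x|k IH c]; first exact: cvg_cst.
by exists (fun=> 0) => // x; exact: is_derive_cst.
Qed.

Lemma smoothk_id k : smoothk k (@id R).
Proof.
case: k => [x|k]; first exact: cvg_id.
by exists (fun=> 1); [move=> x; exact: is_derive_id|exact: smoothk_cst].
Qed.

Lemma smoothkD k f g : smoothk k f -> smoothk k g -> smoothk k (fun x => f x + g x).
Proof.
elim: k f g => [f g cf cg x|k IH f g [f' df sf] [g' dg sg]].
  by apply: continuousD; [exact: cf|exact: cg].
by exists (fun x => f' x + g' x); [move=> x; exact: is_deriveD|exact: IH].
Qed.

Lemma smoothkM k f g : smoothk k f -> smoothk k g -> smoothk k (fun x => f x * g x).
Proof.
elim: k f g => [f g cf cg x|k IH f g [f' df sf] [g' dg sg]].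
  by apply: continuousM; [exact: cf|exact: cg].
exists (fun x => f x * g' x + g x * f' x); first by move=> x; exact: is_deriveM.
by apply: smoothkD; apply: IH => //; apply: smoothkS; [exists f'|exists g'].
Qed.

Lemma smoothk_affine k f (a b : R) : smoothk k f -> smoothk k (fun x => f (a * x + b)).
Proof.
have daff (x : R) : is_derive x 1 (fun x : R => a * x + b) a.
  have -> : (fun x : R => a * x + b) = (cst a * id + cst b) by exact/funext.
  by apply: is_derive_eq; rewrite scaler0 !addr0 [LHS]mulr1.
elim: k f => [f cf x|k IH f [f' df sf]].
  apply: continuous_comp; last exact: cf.
  exact: is_derive_continuous daff x.
exists (fun x => a * f' (a * x + b)); last first.
  by apply: smoothkM; [exact: smoothk_cst|exact: IH].
by move=> x; rewrite mulrC; exact: is_derive1_comp.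
Qed.

Lemma smoothkV k f : (forall x, f x != 0) -> smoothk k f -> smoothk k (fun x => (f x)^-1).
Proof.
move=> f0; elim: k => [cf x|k IH sf].
  by apply: continuousV; [exact: f0|exact: cf].
have [f' df sf'] := sf.
exists (fun x => (- 1 * f' x) * ((f x)^-1 * (f x)^-1)).
  move=> x; have [dfx e] := df x; apply: DeriveDef; first exact: derivableV.
  by rewrite deriveV// e -expr2 mulN1r scaleNr -exprVn [in RHS]mulrC mulrN.
have sV := IH (smoothkS sf).
by apply: smoothkM; apply: smoothkM => //; exact: smoothk_cst.
Qed.

(** The pole [x ^- m] makes the family closed under differentiation, up to linear combinations;
    [m = 0] is the classical flat function exp(-1/x). *)
Definition flat m (x : R) := if 0 < x then x ^- m * expR (- x^-1) else 0.

Lemma flat_ge0 m x : 0 <= flat m x.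
Proof.
by rewrite /flat; case: ifP => // x0; rewrite mulr_ge0 ?expR_ge0// invr_ge0 exprn_ge0// ltW.
Qed.

(** The term of order [m.+1] in the exponential series of [1/x] beats the pole by one factor [x];
    this controls the limits at 0. *)
Lemma flat_le m x : 0 <= x -> flat m x <= m.+1`!%:R * x.
Proof.
move=> x0; rewrite /flat; case: ifPn => [{}x0|_]; last by rewrite mulr_ge0.
have := expR_ge1Dxn m (ltW (_ : 0 < x^-1)); rewrite invr_gt0 => /(_ x0) h.
have {}h : x^-1 ^+ m.+1 / m.+1`!%:R <= expR x^-1 by apply: le_trans h; rewrite lerDr.
rewrite expRN -exprVn ler_pdivrMr ?expR_gt0//.
have f0 : 0 < m.+1`!%:R :> R by rewrite ltr0n fact_gt0.
rewrite ler_pdivrMr// in h.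
have : x * (x^-1 ^+ m.+1) <= x * (expR x^-1 * m.+1`!%:R) by rewrite ler_wpM2l// ltW.
by rewrite exprS mulrA mulfV ?gt_eqF// mul1r => /le_trans; apply; rewrite le_eqVlt; apply/orP; left; apply/eqP; ring.
Qed.

Lemma is_derive_flat m (x : R) :
  is_derive x 1 (flat m) (flat m.+2 x - m%:R * flat m.+1 x).
Proof.
have [x0|x0|->] := ltgtP x 0.
- have -> : flat m.+2 x - m%:R * flat m.+1 x = 0.
    by rewrite /flat ltNge ltW//= mulr0 subr0.
  apply: (@near_eq_is_derive _ _ _ (cst 0)).
  near=> y; rewrite /flat ifF//; apply/negbTE; rewrite -leNgt ltW//.
  by near: y; exact: lt_nbhsl.
- have xn0 : x != 0 by rewrite gt_eqF.
  have dX : is_derive x 1 (fun y : R => y ^+ m) (m%:R * x ^+ m.-1).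
    have -> : (fun y : R => y ^+ m) = id ^+ m.
      by apply/funext => y; rewrite exprfctE.
    by apply: is_derive_eq; rewrite [LHS]mulr1.
  have d1 : is_derive x 1 (fun y : R => (y ^+ m)^-1)
      (- (x ^+ m) ^- 2 * (m%:R * x ^+ m.-1)).
    exact: (@is_deriveV _ (fun y : R => y ^+ m) _ _ _ (expf_neq0 m xn0) dX).
  have d2 : is_derive x 1 (fun y : R => expR (- y^-1)) (expR (- x^-1) * x ^- 2).
    have dV : is_derive x 1 (fun y : R => - y^-1) (x ^- 2).
      apply: (is_derive_eq (is_deriveN (@is_deriveV _ id x _ _ xn0 (is_derive_id x 1)))).
      by rewrite scaleNr opprK [LHS]mulr1.
    exact: (@is_derive1_comp _ expR (fun y : R => - y^-1)).
  have d := is_deriveM d1 d2.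
  apply: near_eq_is_derive; last first.
    apply: is_derive_eq d _.
    rewrite /flat x0 -![_ *: _]/(_ * _) /=.
    case: m {dX d1} => [|m] /=; first by field.
    by rewrite !exprS; field; rewrite xn0 expf_neq0.
  near=> y; rewrite /flat ifT//.
  by near: y; exact: lt_nbhsr.
- have flat0 n : flat n 0 = 0 by rewrite /flat ltxx.
  rewrite !flat0 mulr0 subr0.
  have L : h^-1 *: (flat m (h *: 1 + 0) - flat m 0) @[h --> 0^'] --> (0 : R).
    apply/cvgrPdist_le => e e0; near=> h.
    rewrite flat0 subr0 addr0 sub0r normrN [h *: 1]mulr1 -[_ *: _]/(_ * _).
    have f0 : 0 < m.+2`!%:R :> R by rewrite ltr0n fact_gt0.
    have he : `|h| <= e / m.+2`!%:R.
      near: h; apply: dnbhs0_le; exact: divr_gt0.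
    have [h0|h0] := ltP 0 h; last first.
      by rewrite /flat ifF ?mulr0 ?normr0 ?ltW//; apply/negbTE; rewrite -leNgt.
    (* The difference quotient at 0 stays in the family, and [flat_le] at order [m.+1] bounds it
       linearly, with the factorial already put into the bound on [h]. *)
    have -> : h^-1 * flat m h = flat m.+1 h.
      by rewrite /flat h0 exprS invfM mulrA.
    rewrite ger0_norm ?flat_ge0//; apply: le_trans (flat_le _ (ltW h0)) _.
    by rewrite mulrC -ler_pdivlMr// -[leLHS]gtr0_norm.
  by apply: DeriveDef; [exact: (cvgP _ L)|exact: (cvg_lim _ L)].
Unshelve. all: by end_near. Qed.

Lemma smoothk_flat k m : smoothk k (flat m).
Proof.
elim: k m => [m|k IH m].
  exact: is_derive_continuous (is_derive_flat m).
exists (fun x => flat m.+2 x - m%:R * flat m.+1 x); first exact: is_derive_flat.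
have -> : (fun x => flat m.+2 x - m%:R * flat m.+1 x) =
    (fun x => flat m.+2 x + - m%:R * flat m.+1 x).
  by apply/funext => x; rewrite mulNr.
by apply: smoothkD => //; apply: smoothkM => //; exact: smoothk_cst.
Qed.

Definition step (x : R) := flat 0 x / (flat 0 x + flat 0 (1 - x)).

Let step_den x : 0 < flat 0 x + flat 0 (1 - x).
Proof.
have [x0|x0] := ltP 0 x.
  apply: ltr_pwDl; last exact: flat_ge0.
  by rewrite /flat x0 expr0 invr1 mul1r expR_gt0.
apply: ltr_wpDl; first exact: flat_ge0.
by rewrite /flat ifT ?expr0 ?invr1 ?mul1r ?expR_gt0// subr_gt0; lra.
Qed.

Lemma smooth_step : smooth step.
Proof.
move=> k; apply: smoothkM; first exact: smoothk_flat.
apply: smoothkV => [x|]; first by rewrite gt_eqF// step_den.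
apply: smoothkD; first exact: smoothk_flat.
have -> : (fun x => flat 0 (1 - x)) = (fun x => flat 0 (- 1 * x + 1)).
  by apply/funext => x; congr flat; ring.
exact/smoothk_affine/smoothk_flat.
Qed.

Lemma step_le0 x : x <= 0 -> step x = 0.
Proof. by move=> x0; rewrite /step /flat ifF ?mul0r//; apply/negbTE; rewrite -leNgt. Qed.

Lemma step_ge1 x : 1 <= x -> step x = 1.
Proof.
move=> x1; have := step_den x; rewrite /step.
have -> : flat 0 (1 - x) = 0.
  by rewrite /flat ifF//; apply/negbTE; rewrite -leNgt subr_le0.
by rewrite addr0 => x0; rewrite divff// gt_eqF.
Qed.

Lemma step_ge0 x : 0 <= step x.
Proof. by rewrite divr_ge0 ?flat_ge0// ltW ?step_den. Qed.

Lemma step_le1 x : step x <= 1.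
Proof. by rewrite ler_pdivrMr ?step_den// mul1r lerDl flat_ge0. Qed.

End smooth.

(** * Smooth ramps and their compactly supported combinations *)

Section ramps.
Variable R : realType.
Implicit Types (f g F : R -> R).

(** For [n > 0], a smooth approximation of [pos_part] that is exact outside the interval from 0 to
    [1/n]. *)
Definition ramp (n : R) (z : R) := z * step (n * z).
Definition pos_part (z : R) : R := if 0 < z then z else 0.
Definition heaviside (z : R) : R := if 0 < z then 1 else 0.

(** The derivative of [z * step (n * z)] depends on [n * z] only, so one bound serves for all [n];
    this is the domination needed when [n] tends to infinity. *)
Lemma ramp_spec : exists (D : R -> R) (M : R),
  [/\ continuous D, forall y, y <= 0 -> D y = 0, forall y, 1 < y -> D y = 1,
      forall y, `|D y| <= M &
      forall n x : R, is_derive x 1 (ramp n) (D (n * x))].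
Proof.
have [step' dstep sstep'] := smooth_is_derive (@smooth_step R).
pose D y := step y + y * step' y.
have D0 y : y <= 0 -> D y = 0.
  move=> y0; rewrite /D step_le0// add0r.
  (* At [y = 0], where [step] is constant on the left side only, the factor [y] kills the second
     term. *)
  move: y0; rewrite le_eqVlt => /predU1P[->|y0]; first by rewrite mul0r.
  suff -> : step' y = 0 by rewrite mulr0.
  have [_ <-] := dstep y.
  rewrite (@near_eq_derive _ _ _ _ (cst 0)) ?derive_cst//.
  near=> z; rewrite step_le0// ltW//; near: z; exact: lt_nbhsl.
have D1 y : 1 < y -> D y = 1.
  move=> y1; rewrite /D step_ge1 ?ltW//.
  suff -> : step' y = 0 by rewrite mulr0 addr0.
  have [_ <-] := dstep y.
  rewrite (@near_eq_derive _ _ _ _ (cst (1 : R))) ?derive_cst//.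
  near=> z; rewrite step_ge1// ltW//; near: z; exact: lt_nbhsr.
have cD : continuous D.
  move=> y; apply: continuousD; first exact: (smooth_continuous (@smooth_step R)).
  by apply: continuousM; [exact: cvg_id|exact: (smooth_continuous sstep')].
have [M DM] : exists M, forall y, y \in `[0, 1] -> `|D y| <= M.
  have [y _ yM] := @EVT_max R (fun y => `|D y|) 0 1 ler01
    (continuous_subspaceT (fun y => continuous_comp (cD y) (@norm_continuous _ _ _))).
  by exists `|D y|.
exists D, (Num.max M 1); split => //.
- move=> y; rewrite le_max; have [y0|y0] := leP y 0; first by rewrite D0// normr0 ler01 orbT.
  have [y1|y1] := leP y 1; last by rewrite D1// normr1 lexx orbT.
  by rewrite DM// in_itv/= y1 ltW.
- move=> n x.
  have dn : is_derive x 1 (fun x : R => n * x) n.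
    have -> : (fun x : R => n * x) = (cst n * id) by exact/funext.
    by apply: is_derive_eq; rewrite scaler0 !addr0 [LHS]mulr1.
  have ds : is_derive x 1 (fun x : R => step (n * x)) (step' (n * x) * n).
    exact: (@is_derive1_comp _ (@step R) (fun x : R => n * x) x _ _ (dstep _) dn).
  apply: (is_derive_eq (is_deriveM (is_derive_id x 1) ds)).
  by rewrite /D -![_ *: _]/(_ * _) /=; ring.
Unshelve. all: by end_near. Qed.

Lemma smooth_ramp n : smooth (ramp n).
Proof.
move=> k; apply: smoothkM; first exact: smoothk_id.
have -> : (fun x : R => step (n * x)) = (fun x => step (n * x + 0)).
  by apply/funext => x; rewrite addr0.
exact/smoothk_affine/smooth_step.
Qed.

Lemma ramp_le0 n z : 0 <= n -> z <= 0 -> ramp n z = 0.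
Proof. by move=> n0 z0; rewrite /ramp step_le0 ?mulr0// mulr_ge0_le0. Qed.

Lemma ramp_ge n z : 0 < n -> n^-1 <= z -> ramp n z = z.
Proof. by move=> n0 nz; rewrite /ramp step_ge1 ?mulr1// mulrC -ler_pdivrMr// mul1r. Qed.

Lemma normr_ramp n z : `|ramp n z| <= `|z|.
Proof.
by rewrite normrM ler_piMr// ger0_norm ?step_ge0 ?step_le1.
Qed.

(* With lambda = (a2 - a1) / (b1 - b0) the combination of ramps is compactly
   supported. *)
Definition comb (a1 a2 b0 b1 : R) F s :=
  F (s - a1) - F (s - a2) - (a2 - a1) / (b1 - b0) * (F (s - b0) - F (s - b1)).

Section comb.
Variables a1 a2 b0 b1 : R.
Notation lam := ((a2 - a1) / (b1 - b0)).
Notation comb := (comb a1 a2 b0 b1).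

Lemma smooth_comb F : smooth F -> smooth (comb F).
Proof.
move=> sF k.
have sh (x c : R) : smoothk k (fun s => c * F (s - x)).
  apply: smoothkM; first exact: smoothk_cst.
  have -> : (fun s => F (s - x)) = (fun s => F (1 * s + - x)).
    by apply/funext => s; rewrite mul1r.
  exact/smoothk_affine/sF.
have -> : comb F = (fun s => 1 * F (s - a1) + ((-1) * F (s - a2) +
    (- lam * F (s - b0) + lam * F (s - b1)))).
  by apply/funext => s; rewrite /comb; ring.
by apply: smoothkD => //; apply: smoothkD => //; exact: smoothkD.
Qed.

Lemma is_derive_comb F F' (s : R) : (forall x : R, is_derive x 1 F (F' x)) ->
  is_derive s 1 (comb F) (comb F' s).
Proof.
move=> dF.
have dsh (x : R) : is_derive s 1 (fun s => F (s - x)) (F' (s - x)).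
  have ds : is_derive s 1 (fun s : R => s - x) 1.
    exact: (is_derive_shift s 1 (- x)).
  have := @is_derive1_comp _ F (fun s => s - x) s _ _ (dF (s - x)) ds.
  by rewrite mulr1.
apply: (is_derive_eq (is_deriveB (is_deriveB (dsh a1) (dsh a2))
  (is_deriveZ lam (is_deriveB (dsh b0) (dsh b1))))).
by [].
Qed.

Lemma comb_eq F G s : (forall x, x \in [:: a1; a2; b0; b1] -> F (s - x) = G (s - x)) ->
  comb F s = comb G s.
Proof.
by move=> FG; rewrite /comb !FG ?inE ?eqxx ?orbT.
Qed.

Lemma comb0 s : comb (fun=> 0) s = 0.
Proof. by rewrite /comb !subrr mulr0 subrr. Qed.

(** A ramp is the identity to the right of its transition, so this bounds the support of [comb] on
    the right, as [comb0] does on the left. *)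
Lemma comb_id s : b0 != b1 -> comb id s = 0.
Proof. by move=> b01; rewrite /comb; field; rewrite subr_eq0 eq_sym. Qed.

Lemma normr_comb F M s : 
  (forall x, x \in [:: a1; a2; b0; b1] -> `|F (s - x)| <= M) ->
  `|comb F s| <= (2 + 2 * `|lam|) * M.
Proof.
move=> FM; rewrite /comb.
apply: le_trans (ler_normB _ _) _; rewrite [leRHS]mulrDl; apply: lerD.
  apply: le_trans (ler_normB _ _) _; rewrite mulr_natl mulr2n.
  by apply: lerD; apply: FM; rewrite !inE eqxx ?orbT.
rewrite normrM -mulrA mulrCA ler_wpM2l//.
apply: le_trans (ler_normB _ _) _; rewrite mulr_natl mulr2n.
by apply: lerD; apply: FM; rewrite !inE eqxx ?orbT.
Qed.

End comb.

Lemma near_ramp z : \forall n \near \oo, ramp n.+1%:R z = pos_part z.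
Proof.
rewrite /pos_part; case: ltP => z0; last by near=> n; rewrite ramp_le0.
near=> n; rewrite ramp_ge//.
apply: ltW; near: n; exact: (near_infty_natSinv_lt (PosNum z0)).
Unshelve. all: by end_near. Qed.

End ramps.

(** * From weak derivatives to absolute continuity on lines *)

Section helpers.
Context d (T : measurableType d) (R : realType).
Variable mu : {measure set T -> \bar R}.

Lemma le_integrable_scale (f h : T -> R) (M : R) :
  mu.-integrable setT (EFin \o f) -> measurable_fun setT h ->
  (forall x, `|h x| <= M * `|f x|) -> mu.-integrable setT (EFin \o h).
Proof.
move=> fi mh hM.
apply: (@le_integrable _ _ _ mu _ measurableT _ (fun x => M%:E * (EFin \o f) x)%E).
- exact/measurable_EFinP.
- move=> x _; rewrite /= lee_fin normrM; apply: le_trans (hM x) _.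
  by rewrite ler_wpM2r// ler_norm.
- exact: integrableZl.
Qed.

Lemma dominated_Rintegral0 (f h : T -> R) (hn : nat -> T -> R) (M : R) :
  mu.-integrable setT (EFin \o f) -> measurable_fun setT h ->
  (forall n, measurable_fun setT (hn n)) ->
  (forall n x, `|hn n x| <= M * `|f x|) ->
  (forall x, \forall n \near \oo, hn n x = h x) ->
  (\forall n \near \oo, \int[mu]_x hn n x = 0) ->
  \int[mu]_x h x = 0.
Proof.
move=> fi mh mhn hM hnh hn0.
have iM : mu.-integrable setT (fun x => (M * `|f x|)%:E).
  by under eq_fun do rewrite EFinM; apply: integrableZl => //; exact: integrable_norm fi.
have ihn n : mu.-integrable setT (EFin \o hn n) by exact: le_integrable_scale fi _ (hM n).
have [|||||_ _ L] := @dominated_convergence _ _ _ mu setT measurableT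
  (fun n => EFin \o hn n) (EFin \o h) (fun x => (M * `|f x|)%:E).
- by move=> n; exact/measurable_EFinP.
- exact/measurable_EFinP.
- apply: aeW => x _; apply: cvg_near_cst.
  by apply: filterS (hnh x) => n /= ->.
- exact: iM.
- by apply: aeW => x n _; rewrite /= lee_fin.
rewrite /Rintegral.
suff -> : (\int[mu]_x (h x)%:E = 0)%E by [].
apply: (cvg_unique _ L) => //; apply: cvg_near_cst.
near=> n => /=.
have : \int[mu]_x hn n x = 0 by near: n.
(* The real integral is [fine] of the extended one, and [fine] also sends infinite values to 0;
   integrability excludes these. *)
rewrite /Rintegral => h0; rewrite -[LHS]fineK ?h0//.
exact: integrable_fin_num (ihn n).
Unshelve. all: by end_near. Qed.

Lemma integrable_addr (D : set T) (f h : T -> R) : measurable D ->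
  mu.-integrable D (EFin \o f) -> mu.-integrable D (EFin \o h) ->
  mu.-integrable D (EFin \o (fun x => f x + h x)).
Proof. by move=> mD fi hi; exact: (integrableD mD fi hi). Qed.

Lemma integrable_subr (D : set T) (f h : T -> R) : measurable D ->
  mu.-integrable D (EFin \o f) -> mu.-integrable D (EFin \o h) ->
  mu.-integrable D (EFin \o (fun x => f x - h x)).
Proof. by move=> mD fi hi; exact: (integrableB mD fi hi). Qed.

Lemma integrable_cstr (D : set T) (k : R) : measurable D -> (mu D < +oo)%E ->
  mu.-integrable D (EFin \o (fun=> k)).
Proof.
move=> mD Doo; apply: measurable_bounded_integrable => //.
by exists `|k|; split; [exact: num_real|move=> z kz s _; exact: ltW].
Qed.

End helpers.

Section line.
Variable R : realType.
Notation mu := (@lebesgue_measure R).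

Lemma near_rat (P : R -> Prop) (x y : R) : x < y -> (\forall z \near x, P z) ->
  exists2 q : rat, x < ratr q < y & P (ratr q).
Proof.
move=> xy /nbhs_ballP[e /= e0 xe].
have : x < Num.min y (x + e) by rewrite lt_min xy ltrDl.
move=> /rat_in_itvoo[q]; rewrite in_itv/= lt_min => /and3P[xq qy qe].
exists q; first by rewrite xq.
apply: xe; rewrite /ball/= ltr_distlC; apply/andP; split; lra.
Qed.

(** With rational endpoints only, the hypothesis can be secured on almost every line at once. The
    primitive takes a single value at the rationals of the interval; where it has derivative [f x],
    continuity and difference quotients along rationals force this derivative to be 0. *)
Lemma zero_integral_ae (f : R -> R) (a b : R) :
  mu.-integrable setT (EFin \o f) ->
  (forall p q : rat, a < ratr p -> ratr p < ratr q :> R -> ratr q < b ->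
    \int[mu]_(x in `]ratr p, ratr q]) f x = 0) ->
  {ae mu, forall x, a < x < b -> f x = 0}.
Proof.
move=> fi f0.
have fiS (A : set R) : measurable A -> mu.-integrable A (EFin \o f).
  by move=> mA; exact: integrableS fi.
have := FTC1Ny (fun y => fiS _ (measurable_itv _)) (open_integrable_locally openT fi).
set F := (fun x => _).
apply: filterS; first exact: (ae_filter_ringOfSetsType mu).
move=> x [dF <-] /andP[ax xb].
have FE (p q : rat) : a < ratr p -> ratr p < ratr q :> R -> ratr q < b ->
    F (ratr p) = F (ratr q).
  move=> ap pq qb; apply/esym/eqP; rewrite -subr_eq0 /F.
  rewrite Rintegral_itvB ?f0 ?eqxx//; last by rewrite bnd_simp ltW.
  exact: fiS.
have cF : {for x, continuous F}.
  by apply: differentiable_continuous; apply/derivable1_diffP.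
have FK (q : rat) : x < ratr q -> ratr q < b -> F (ratr q) = F x.
  move=> xq qb; apply/eqP/negPn/negP => Fq.
  have : \forall z \near x, F z != F (ratr q).
    by apply: (cF [set w | w != F (ratr q)]); apply: open_nbhs_nbhs; split; [exact: open_neq|rewrite /= eq_sym].
  move=> /(near_rat xq)[p /andP[xp pq]] /negP; apply; apply/eqP.
  by apply: FE => //; exact: lt_trans xp.
apply/eqP/negPn/negP => F'0.
have L : h^-1 *: ((F \o shift x) (h *: 1) - F x) @[h --> 0^'] --> (F^`())%classic x.
  by rewrite derive1E; exact: dF.
have : \forall h \near 0^', h^-1 *: ((F \o shift x) (h *: 1) - F x) != 0.
  by apply: (L [set w | w != 0]); apply: open_nbhs_nbhs; split; [exact: open_neq|].
rewrite near_withinE => /nbhs_ballP[e /= e0 he].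
have xe : \forall z \near x, z - x < e.
  by near=> z; rewrite ltrBlDl; near: z; apply: lt_nbhsl; rewrite ltrDl.
have [q /andP[xq qb] qe] := near_rat xb xe.
have /he : ball (0 : R) e (ratr q - x).
  by rewrite /ball/= sub0r normrN gtr0_norm// subr_gt0.
rewrite subr_eq0 gt_eqF// => /(_ isT) /negP; apply.
by rewrite /= [_ *: 1]mulr1 subrK FK// subrr scaler0.
Unshelve. all: by end_near. Qed.

End line.

Lemma integrable_tensor d1 d2 (T1 : measurableType d1) (T2 : measurableType d2)
    (R : realType) (m1 : {sigma_finite_measure set T1 -> \bar R})
    (m2 : {sigma_finite_measure set T2 -> \bar R}) (f : T1 -> R) (h : T2 -> R) :
  m1.-integrable setT (EFin \o f) -> m2.-integrable setT (EFin \o h) ->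
  (m1 \x m2)%E.-integrable setT (EFin \o (fun p : T1 * T2 => f p.1 * h p.2)).
Proof.
move=> fi hi.
have mf : measurable_fun setT f by apply/measurable_EFinP; exact: measurable_int fi.
have mh : measurable_fun setT h by apply/measurable_EFinP; exact: measurable_int hi.
have mfh : measurable_fun setT (EFin \o (fun p : T1 * T2 => f p.1 * h p.2)).
  apply/measurable_EFinP; apply: measurable_funM.
    by apply: measurableT_comp => //; exact: measurable_fst.
  by apply: measurableT_comp => //; exact: measurable_snd.
apply/(integrable12ltyP m1 m2 mfh).
move/integrableP : fi => [_ fi]; move/integrableP : (hi) => [_ hoo].
have h0 : (0 <= \int[m2]_y `|(h y)%:E|)%E by apply: integral_ge0.
set C := (\int[m2]_y `|(h y)%:E|)%E in hoo h0 *.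
have E x : (\int[m2]_y `|(f x * h y)%:E| = `|(f x)%:E| * C)%E.
  rewrite -ge0_integralZl//; last first.
    by apply: measurableT_comp => //; exact/measurable_EFinP.
  by apply: eq_integral => y _; rewrite EFinM abseM.
rewrite (eq_integral (fun x => `|(f x)%:E| * C)%E); last by move=> x _; exact: E.
rewrite ge0_integralZr//; last by apply: measurableT_comp => //; exact/measurable_EFinP.
have f0 : (0 <= \int[m1]_x `|(f x)%:E|)%E by apply: integral_ge0.
by apply: lte_mul_pinfty => //; rewrite ge0_fin_numE.
Qed.

Section acl1.
Variable R : realType.
Notation mu := (@lebesgue_measure R).

Lemma heaviside_indic : @heaviside R = \1_(`]0, +oo[%classic).
Proof.
apply/funext => z; rewrite /heaviside indicE.
by case: ltP => z0; [rewrite mem_set//= in_itv/= z0|rewrite memNset//= in_itv/= andbT ltNge z0].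
Qed.

Lemma measurable_heaviside : measurable_fun setT (@heaviside R).
Proof. by rewrite heaviside_indic; apply: measurable_indic; exact: measurable_itv. Qed.

Lemma measurable_pos_part : measurable_fun setT (@pos_part R).
Proof.
have -> : @pos_part R = (fun z => z * heaviside z).
  by apply/funext => z; rewrite /pos_part /heaviside; case: ifP => _; rewrite ?mulr1 ?mulr0.
by apply: measurable_funM => //; exact: measurable_heaviside.
Qed.

Lemma heavisideB (x1 x2 s : R) : x1 <= x2 ->
  heaviside (s - x1) - heaviside (s - x2) = \1_(`]x1, x2]%classic) s.
Proof.
move=> x12; rewrite indicE /heaviside !subr_gt0.
have [s1|s1] := ltP x1 s; last first.
  rewrite ltNge (le_trans s1 x12)/= subrr memNset//=.
  by rewrite in_itv/= ltNge s1.
have [s2|s2] := ltP x2 s.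
  by rewrite subrr memNset//= in_itv/= [_ <= x2]leNgt s2 andbF.
by rewrite subr0 mem_set//= in_itv/= s1.
Qed.

Lemma lebesgue_measure_itvoc (x y : R) : x <= y ->
  mu `]x, y]%classic = (y - x)%:E.
Proof.
rewrite lebesgue_measure_itv/= lte_fin le_eqVlt => /predU1P[->|->].
  by rewrite ltxx subrr.
by rewrite EFinB.
Qed.

Lemma pos_partB (x1 x2 s : R) : x1 <= x2 ->
  (\int[mu]_x (heaviside (s - x) * \1_(`]x1, x2]%classic) x)%:E)%E =
  (pos_part (s - x1) - pos_part (s - x2))%:E.
Proof.
move=> x12; set A := `]x1, x2]%classic.
have mA : measurable A by exact: measurable_itv.
have mB (y : R) : measurable `]-oo, y[%classic by exact: measurable_itv.
have -> : (fun x => (heaviside (s - x) * \1_A x)%:E) =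
    (fun x => (\1_(A `&` `]-oo, s[%classic) x)%:E).
  apply/funext => x; congr EFin; rewrite indicI /= mulrC; congr (_ * _).
  rewrite /heaviside subr_gt0 indicE; case: ltP => xs.
    by rewrite mem_set//= in_itv.
  by rewrite memNset//= in_itv/= ltNge xs.
rewrite integral_indic//; last exact: measurableI.
rewrite setIT /pos_part !subr_gt0.
have [s1|s1] := ltP x1 s; last first.
  rewrite ltNge (le_trans s1 x12)/= subrr.
  rewrite (_ : _ `&` _ = set0) ?measure0//; apply/seteqP; split => // x [].
  rewrite /A/= !in_itv/= => /andP[x1x _] xs.
  by move: (lt_le_trans (lt_trans x1x xs) s1); rewrite ltxx.
have [s2|s2] := ltP x2 s.
  rewrite (_ : _ `&` _ = A) ?[LHS]lebesgue_measure_itvoc//.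
    by congr EFin; ring.
  apply/seteqP; split => [x []//|x /[dup] Ax]; rewrite /A/= !in_itv/= => /andP[_ xx].
  by split => //=; rewrite (le_lt_trans xx).
rewrite subr0 (_ : _ `&` _ = `]x1, s[%classic).
  by rewrite [LHS]lebesgue_measure_itv/= lte_fin s1 EFinB.
apply/seteqP; split=> [x []|x]; rewrite /A/= !in_itv/=; first by move=> /andP[-> _].
by move=> /andP[-> xs]; rewrite (le_trans (ltW xs)).
Qed.

Section primitive.
Variable g : R -> R.
Hypothesis gi : mu.-integrable setT (EFin \o g).

Let giS (A : set R) : measurable A -> mu.-integrable A (EFin \o g).
Proof. by move=> mA; exact: integrableS gi. Qed.

(** A primitive of [- g]. Integrating to the right of [x] makes Fubini produce [pos_part], the limit
    of the ramps. *)
Definition tail (x : R) := \int[mu]_(s in `]x, +oo[) g s.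

Lemma tail_modulus a b : integral_modulus a b (fun s => `|g s|) (fun x => - tail x).
Proof.
move=> x y ax xy yb; rewrite opprK addrC /tail.
have <- : \int[mu]_(s in `]x, y]) g s =
    \int[mu]_(s in `]x, +oo[) g s - \int[mu]_(s in `]y, +oo[) g s.
  apply/eqP; rewrite eq_sym subr_eq addrC -subr_eq eq_sym.
  by rewrite -(@Rintegral_itvB _ g (BRight x) (BInfty _ false) y)//; exact: giS.
apply: le_trans (le_normr_Rintegral _ (giS (measurable_itv _))) _ => //.
rewrite Rintegral_itv_bndo_bndc//.
by apply: integrable_norm; exact: giS.
Qed.

Lemma measurable_tail : measurable_fun setT tail.
Proof.
have -> : tail = (fun x => - (- tail x)) by apply/funext => x; rewrite opprK.
apply: measurableT_comp => //; apply: continuous_measurable_fun => x.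
apply: (@integral_modulus_continuous _ (x - 1) (x + 1) (fun s => `|g s|)).
- by move=> z.
- exact: integrable_norm gi.
- exact: tail_modulus.
- by rewrite ltrBlDr ltrDl ltr01.
Qed.

Lemma tailE x : tail x = \int[mu]_s (g s * heaviside (s - x)).
Proof.
rewrite /tail Rintegral_mkcond; apply: eq_Rintegral => s _.
rewrite patchE /heaviside subr_gt0; case: ltP => xs.
  by rewrite mem_set ?mulr1//= in_itv/= xs.
by rewrite memNset ?mulr0//= in_itv/= andbT ltNge xs.
Qed.

Lemma normr_tail x : `|tail x| <= \int[mu]_s `|g s|.
Proof.
rewrite /tail; apply: le_trans (le_normr_Rintegral _ (giS (measurable_itv _))) _ => //.
by apply: ge0_subset_Rintegral => //; exact: integrable_norm gi.
Qed.

Lemma Rintegral_tail (x1 x2 : R) : x1 <= x2 ->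
  \int[mu]_(x in `]x1, x2]) tail x =
  \int[mu]_s (g s * (pos_part (s - x1) - pos_part (s - x2))).
Proof.
move=> x12; set A := `]x1, x2]%classic.
have mA : measurable A by exact: measurable_itv.
pose k (p : R * R) : \bar R := (g p.1 * (heaviside (p.1 - p.2) * \1_A p.2))%:E.
have mg : measurable_fun setT g by apply/measurable_EFinP; exact: measurable_int gi.
have mk : measurable_fun setT k.
  apply/measurable_EFinP; apply: measurable_funM.
    by apply: measurableT_comp => //; exact: measurable_fst.
  apply: measurable_funM.
    apply: measurableT_comp; first exact: measurable_heaviside.
    by apply: measurable_funB; [exact: measurable_fst|exact: measurable_snd].
  apply: measurableT_comp; last exact: measurable_snd.
  exact: measurable_indic.
have ik : (mu \x mu)%E.-integrable setT k.
  have iA : mu.-integrable setT (EFin \o (\1_A : R -> R)).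
    exact: integrable_indic_itv.
  apply: (le_integrable_scale (M := 1) (integrable_tensor gi iA)).
    exact/measurable_EFinP.
  move=> p; rewrite mul1r /= mulrCA [leLHS]normrM ler_piMl// /heaviside.
  by case: ifP; rewrite ?normr1 ?normr0.
transitivity (fine (\int[mu]_x \int[mu]_s k (s, x))%E); last first.
  rewrite -(Fubini ik) /Rintegral; congr fine; apply: eq_integral => s _.
  rewrite [RHS]EFinM -pos_partB// -integralZl//.
  have iA : mu.-integrable setT (EFin \o (\1_A : R -> R)).
    exact: integrable_indic_itv.
  apply: (le_integrable_scale (M := 1) iA).
    apply: measurable_funM; last exact: measurable_indic.
    apply: measurableT_comp; first exact: measurable_heaviside.
    exact: measurable_funB.
  move=> x; rewrite normrM ler_wpM2r// /heaviside.
  by case: ifP; rewrite ?normr1 ?normr0.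
rewrite /Rintegral integral_mkcond; congr fine.
apply: eq_integral => x _; rewrite patchE; case: ifPn => [|xA]; last first.
  rewrite integral0_eq// => s _.
  by rewrite /k /= indicE (negbTE xA) !mulr0.
rewrite inE => xA; rewrite tailE /Rintegral fineK; last first.
  apply: integrable_fin_num => //; apply: (le_integrable_scale (M := 1) gi).
    apply: measurable_funM => //.
    apply: measurableT_comp; first exact: measurable_heaviside.
    exact: measurable_funB.
  move=> s; rewrite mul1r normrM ler_piMr// /heaviside.
  by case: ifP; rewrite ?normr1 ?normr0.
by apply: eq_integral => s _; rewrite /k /= indicE mem_set// mulr1.
Qed.

End primitive.
End acl1.

Section line_acl.
Variable R : realType.
Notation mu := (@lebesgue_measure R).

Lemma integrable_tail (g : R -> R) (a b : R) (x y : bool) :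
  mu.-integrable setT (EFin \o g) ->
  mu.-integrable [set` Interval (BSide x a) (BSide y b)] (EFin \o tail g).
Proof.
move=> gi; apply: measurable_bounded_integrable.
- exact: measurable_itv.
- rewrite [ltLHS]lebesgue_measure_itv/=; case: ifP => // _.
  by rewrite -EFinB ltry.
- by apply: measurable_funTS; exact: measurable_tail.
- exists (\int[mu]_s `|g s|); split; first exact: num_real.
  by move=> z gz s _; apply: le_trans (normr_tail gi s) (ltW gz).
Qed.

Section fixed.
Variables (u g : R -> R).
Hypotheses (ui : mu.-integrable setT (EFin \o u)) (gi : mu.-integrable setT (EFin \o g)).

Let iuH (x1 x2 : R) : x1 <= x2 ->
  mu.-integrable setT (EFin \o (fun s => u s * (heaviside (s - x1) - heaviside (s - x2)))).
Proof.
move=> x12; apply: (le_integrable_scale (M := 1) ui).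
  apply: measurable_funM; first exact/measurable_EFinP/measurable_int/ui.
  by apply: measurable_funB; (apply: measurableT_comp; first exact: measurable_heaviside); exact: measurable_funB.
move=> s; rewrite heavisideB// mul1r normrM ler_piMr// indicE.
by case: (_ \in _); rewrite ?normr1 ?normr0.
Qed.

Let igP (x1 x2 : R) : x1 <= x2 ->
  mu.-integrable setT (EFin \o (fun s => g s * (pos_part (s - x1) - pos_part (s - x2)))).
Proof.
move=> x12; apply: (le_integrable_scale (M := x2 - x1) gi).
  apply: measurable_funM; first exact/measurable_EFinP/measurable_int/gi.
  by apply: measurable_funB; (apply: measurableT_comp; first exact: measurable_pos_part); exact: measurable_funB.
move=> s; rewrite normrM mulrC ler_wpM2r// /pos_part !subr_gt0.
by rewrite ler_norml; case: (ltP x1 s) => ?; case: (ltP x2 s) => ?; apply/andP; split; lra.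
Qed.

Let L (x1 x2 : R) := \int[mu]_(s in `]x1, x2]) (u s + tail g s).

Let LE (x1 x2 : R) : x1 <= x2 -> L x1 x2 =
  \int[mu]_s (u s * (heaviside (s - x1) - heaviside (s - x2)) +
              g s * (pos_part (s - x1) - pos_part (s - x2))).
Proof.
move=> x12; rewrite RintegralD//; [|exact: iuH|exact: igP].
rewrite -Rintegral_tail// /L RintegralD//; last 2 first.
- by apply: integrableS ui => //; exact: measurable_itv.
- exact: integrable_tail.
- congr (_ + _); rewrite Rintegral_mkcond; apply: eq_Rintegral => s _.
  by rewrite heavisideB// patchE indicE; case: ifP => _; rewrite ?mulr1 ?mulr0.
Qed.

(** Since [comb] of [heaviside] is the derivative of [comb] of [pos_part], the hypothesis is the
    weak equation on one line. By [Rintegral_tail] it says that [u + tail g] has the same mean over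
    every rational interval as over the reference interval from [b0] to [b1]; so it equals that mean
    [k] almost everywhere. *)
Lemma line_acl (a b b0 b1 : R) : a < b0 -> b0 < b1 -> b1 < b ->
  (forall p q : rat, a < ratr p -> ratr p < ratr q :> R -> ratr q < b ->
    \int[mu]_s (u s * comb (ratr p) (ratr q) b0 b1 (@heaviside R) s +
      g s * comb (ratr p) (ratr q) b0 b1 (@pos_part R) s) = 0) ->
  exists k, {ae mu, forall s, a < s < b -> u s = k - tail g s}.
Proof.
move=> ab0 b01 b1b H; pose k := L b0 b1 / (b1 - b0); exists k.
have Lpq (p q : rat) : a < ratr p -> ratr p < ratr q :> R -> ratr q < b ->
    L (ratr p) (ratr q) = k * (ratr q - ratr p).
  move=> ap pq qb; have := H p q ap pq qb.
  set lam := (ratr q - ratr p) / (b1 - b0).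
  rewrite (_ : (fun s => _) = (fun s =>
      (u s * (heaviside (s - ratr p) - heaviside (s - ratr q)) +
       g s * (pos_part (s - ratr p) - pos_part (s - ratr q))) -
      lam * (u s * (heaviside (s - b0) - heaviside (s - b1)) +
       g s * (pos_part (s - b0) - pos_part (s - b1))))); last first.
    by apply/funext => s; rewrite /comb -/lam; ring.
  have i1 (x1 x2 : R) : x1 <= x2 -> mu.-integrable setT (EFin \o (fun s =>
      u s * (heaviside (s - x1) - heaviside (s - x2)) +
      g s * (pos_part (s - x1) - pos_part (s - x2)))).
    by move=> x12; exact: integrableD (iuH x12) (igP x12).
  rewrite RintegralB//; last 2 first.
    exact/i1/ltW.
    exact: (integrableZl measurableT lam (i1 _ _ (ltW b01))).
  rewrite RintegralZl//; last exact/i1/ltW.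
  rewrite -!LE ?ltW// => /eqP; rewrite subr_eq0 => /eqP ->.
  by rewrite /lam /k; field; rewrite subr_eq0 gt_eqF.
(* The constant [k] becomes integrable only after restriction to the bounded interval. *)
pose f := (fun s => u s + tail g s - k) \_ `]a, b[.
have fi : mu.-integrable setT (EFin \o f).
  rewrite /f -restrict_EFin; apply: (@proj1 _ _ (@integrable_mkcond _ _ _ mu `]a, b[%classic _ _)).
    exact: measurable_itv.
  apply: integrable_subr; [exact: measurable_itv| |].
    apply: integrable_addr; [exact: measurable_itv| |exact: integrable_tail].
    by apply: integrableS ui => //; exact: measurable_itv.
  apply: integrable_cstr; first exact: measurable_itv.
  rewrite [ltLHS]lebesgue_measure_itv/=; case: ifP => // _.
  by rewrite -EFinB ltry.
suff f0 : forall p q : rat, a < ratr p -> ratr p < ratr q :> R -> ratr q < b ->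
    \int[mu]_(x in `]ratr p, ratr q]) f x = 0.
  have := zero_integral_ae fi f0.
  apply: filterS; first exact: (ae_filter_ringOfSetsType mu).
  move=> s fs abs; have := fs abs; rewrite /f patchE mem_set//= => /eqP.
  by rewrite subr_eq0 => /eqP <-; rewrite addrK.
move=> p q ap pq qb.
  rewrite (_ : \int[mu]_(x in _) _ =
     \int[mu]_(x in `]ratr p, ratr q]) (u x + tail g x - k)); last first.
    apply: eq_Rintegral => s; rewrite inE/= in_itv/= => /andP[ps sq].
    by rewrite /f patchE mem_set//= in_itv/= (lt_trans ap)// (le_lt_trans sq).
  have mI : measurable (`]ratr p, ratr q]%classic : set R) by exact: measurable_itv.
  rewrite RintegralB//; last 2 first.
  - apply: integrable_addr => //; last exact: integrable_tail.
    by apply: integrableS ui.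
  - apply: integrable_cstr => //.
    by rewrite [ltLHS]lebesgue_measure_itvoc ?ltry// ltW.
  rewrite Rintegral_cst// [X in fine X]lebesgue_measure_itvoc ?ltW//=.
  by rewrite -/(L _ _) Lpq// subrr.
Qed.

End fixed.
End line_acl.

(** * Product test functions and their nonsmooth limits *)

Section tensor.
Variable R : realType.
Notation mu := (@lebesgue_measure R).

(** Product test functions suffice, because the second factor localizes the equation to almost every
    line. The integrals run over the whole plane: this is meant for functions cut off to the
    rectangle. *)
Definition tensor_weak (a b c e : R) (u g : R * R -> R) :=
  forall (f f' psi : R -> R) (a1 b1 c1 e1 : R),
  smooth f -> (forall x : R, is_derive x 1 f (f' x)) -> smooth psi ->
  a < a1 -> b1 < b -> c < c1 -> e1 < e ->
  (forall s, ~~ (a1 <= s <= b1) -> f s = 0) ->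
  (forall t, ~~ (c1 <= t <= e1) -> psi t = 0) ->
  \int[leb2 R]_p (u p * (f' p.1 * psi p.2)) =
  - \int[leb2 R]_p (g p * (f p.1 * psi p.2)).

Lemma near_step (z : R) : \forall n \near \oo, step (n.+1%:R * z) = heaviside z.
Proof.
rewrite /heaviside; case: ltP => z0; last first.
  by near=> n; rewrite step_le0// mulr_ge0_le0.
near=> n; rewrite step_ge1// mulrC -ler_pdivrMr// mul1r.
by apply: ltW; near: n; exact: (near_infty_natSinv_lt (PosNum z0)).
Unshelve. all: by end_near. Qed.

Lemma near_dramp (D : R -> R) (z : R) : (forall y, y <= 0 -> D y = 0) ->
  (forall y, 1 < y -> D y = 1) ->
  \forall n \near \oo, D (n.+1%:R * z) = heaviside z.
Proof.
move=> D0 D1; rewrite /heaviside; case: ltP => z0; last first.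
  by near=> n; rewrite D0// mulr_ge0_le0.
near=> n; rewrite D1// mulrC -ltr_pdivrMr// mul1r.
by near: n; exact: (near_infty_natSinv_lt (PosNum z0)).
Unshelve. all: by end_near. Qed.

Lemma measurable_comb (x y b0 b1 : R) (F : R -> R) :
  measurable_fun setT F -> measurable_fun setT (comb x y b0 b1 F).
Proof.
move=> mF.
have mFs (z : R) : measurable_fun setT (fun s : R => F (s - z)).
  by apply: measurableT_comp => //; exact: measurable_funB.
apply: measurable_funB; first exact: measurable_funB.
by apply: measurable_funM => //; exact: measurable_funB.
Qed.

Lemma near_comb (x y b0 b1 s : R) (F : nat -> R -> R) (G : R -> R) :
  (forall z, \forall n \near \oo, F n z = G z) ->
  \forall n \near \oo, comb x y b0 b1 (F n) s = comb x y b0 b1 G s.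
Proof.
move=> FG; near=> n; apply: comb_eq => z; rewrite !inE.
by move=> /or4P[] /eqP ->; near: n; exact: FG.
Unshelve. all: by end_near. Qed.

Section limit.
Variables (a b c e : R) (u g : R * R -> R).
Hypotheses (ui : (leb2 R).-integrable setT (EFin \o u))
           (gi : (leb2 R).-integrable setT (EFin \o g)).
Hypothesis g0 : forall p, ~~ (a <= p.1 <= b) -> g p = 0.
Hypothesis tw : tensor_weak a b c e u g.

Let meas_u : measurable_fun setT u.
Proof. by apply/measurable_EFinP; exact: measurable_int ui. Qed.
Let meas_g : measurable_fun setT g.
Proof. by apply/measurable_EFinP; exact: measurable_int gi. Qed.
Let meas_fst (f : R -> R) : measurable_fun setT f ->
  measurable_fun setT (fun p : R * R => f p.1).
Proof. by move=> mf; apply: measurableT_comp => //; exact: measurable_fst. Qed.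
Let meas_snd (f : R -> R) : measurable_fun setT f ->
  measurable_fun setT (fun p : R * R => f p.2).
Proof. by move=> mf; apply: measurableT_comp => //; exact: measurable_snd. Qed.

Section knots.
Variables (x y b0 b1 : R).
Hypotheses (xy : x < y) (b01 : b0 < b1) (ax : a < x) (yb : y < b)
  (ab0 : a < b0) (b1b : b1 < b).
Notation comb := (comb x y b0 b1).
Notation K := (2 + 2 * `|(y - x) / (b1 - b0)|).

Let K0 : 0 <= K. Proof. by rewrite addr_ge0// mulr_ge0. Qed.

Let knot z : z \in [:: x; y; b0; b1] -> a < z < b.
Proof.
rewrite !inE => /or4P[] /eqP ->; apply/andP; split=> //.
- exact: lt_trans yb.
- exact: lt_trans xy.
- exact: lt_trans b1b.
- exact: lt_trans b01.
Qed.

Let bound_g F p : (forall z, `|F z| <= `|z|) ->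
  `|g p * comb F p.1| <= K * (b - a) * `|g p|.
Proof.
move=> Fz; have [/andP[ap pb]|/g0 ->] := boolP (a <= p.1 <= b); last first.
  by rewrite mul0r normr0 mulr0.
rewrite normrM mulrC ler_wpM2r//; apply: normr_comb => z /knot/andP[az zb].
apply: le_trans (Fz _) _; rewrite ler_norml; apply/andP; split; lra.
Qed.

Let bound_u F M p : (forall z, `|F z| <= M) ->
  `|u p * comb F p.1| <= K * M * `|u p|.
Proof.
by move=> FM; rewrite normrM mulrC ler_wpM2r//; apply: normr_comb.
Qed.

Let normr_pos_part (z : R) : `|pos_part z| <= `|z|.
Proof. by rewrite /pos_part; case: ifP; rewrite ?normr0. Qed.

Let normr_heaviside (z : R) : `|heaviside z| <= 1.
Proof. by rewrite /heaviside; case: ifP; rewrite ?normr1 ?normr0. Qed.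

Lemma integrable_comb : (leb2 R).-integrable setT (EFin \o
  (fun p => u p * comb (@heaviside R) p.1 + g p * comb (@pos_part R) p.1)).
Proof.
apply: integrable_addr => //.
  apply: (le_integrable_scale (M := K * 1) ui); last by move=> p; exact: bound_u.
  apply: measurable_funM => //; apply: meas_fst; apply: measurable_comb.
  exact: measurable_heaviside.
apply: (le_integrable_scale (M := K * (b - a)) gi); last by move=> p; exact: bound_g.
apply: measurable_funM => //; apply: meas_fst; apply: measurable_comb.
exact: measurable_pos_part.
Qed.

(** At each point the smooth profiles coincide with their limits from some [n] on, and they are
    dominated uniformly in [n], so the equation passes to the nonsmooth profiles. *)
Lemma tensor_limit (t1 t2 : R) : c < t1 -> t1 < t2 -> t2 < e ->
  \int[leb2 R]_p ((u p * comb (@heaviside R) p.1 + g p * comb (@pos_part R) p.1) *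
    (heaviside (p.2 - t1) - heaviside (p.2 - t2))) = 0.
Proof.
move=> ct1 t12 t2e.
have [D [M [cD D0 D1 DM dD]]] := ramp_spec R.
have M0 : 0 <= M by apply: le_trans (DM 0).
pose N n : R := n.+1%:R.
pose phi n := comb (ramp (N n)).
pose phi' n := comb (fun z => D (N n * z)).
pose psi n t := step (N n * (t - t1)) - step (N n * (t - t2)).
have psi1 n t : `|psi n t| <= 1.
  have := step_ge0 (N n * (t - t1)); have := step_le1 (N n * (t - t1)).
  have := step_ge0 (N n * (t - t2)); have := step_le1 (N n * (t - t2)).
  by rewrite ler_norml /psi => ? ? ? ?; apply/andP; split; lra.
have mstep : measurable_fun setT (@step R).
  by apply: continuous_measurable_fun; exact: (smooth_continuous (@smooth_step R)).
have mstepN n (z : R) : measurable_fun setT (fun t : R => step (N n * (t - z))).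
  apply: measurableT_comp => //; apply: measurable_funM => //.
  exact: measurable_funB.
have mpsi n : measurable_fun setT (psi n) by apply: measurable_funB.
have mphi n : measurable_fun setT (phi n).
  apply: measurable_comb; apply: continuous_measurable_fun.
  exact: (smooth_continuous (@smooth_ramp R _)).
have mphi' n : measurable_fun setT (phi' n).
  apply: measurable_comb; apply: measurableT_comp; first exact: continuous_measurable_fun.
  exact: measurable_funM.
have bu n p : `|u p * (phi' n p.1 * psi n p.2)| <= K * M * `|u p|.
  rewrite mulrA normrM -[leRHS]mulr1; apply: ler_pM => //.
  exact: bound_u.
have bg n p : `|g p * (phi n p.1 * psi n p.2)| <= K * (b - a) * `|g p|.
  rewrite mulrA normrM -[leRHS]mulr1; apply: ler_pM => //.
  by apply: bound_g => z; exact: normr_ramp.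
have iu n : (leb2 R).-integrable setT (EFin \o (fun p => u p * (phi' n p.1 * psi n p.2))).
  apply: (le_integrable_scale ui _ (bu n)).
  by apply: measurable_funM => //; apply: measurable_funM; [exact: meas_fst|exact: meas_snd].
have ig n : (leb2 R).-integrable setT (EFin \o (fun p => g p * (phi n p.1 * psi n p.2))).
  apply: (le_integrable_scale gi _ (bg n)).
  by apply: measurable_funM => //; apply: measurable_funM; [exact: meas_fst|exact: meas_snd].
have ba : 0 <= b - a by rewrite subr_ge0 ltW// (lt_trans ax)// (lt_trans xy).
apply: (@dominated_Rintegral0 _ _ _ (leb2 R) (fun p => `|u p| + `|g p|) _
  (fun n p => u p * (phi' n p.1 * psi n p.2) + g p * (phi n p.1 * psi n p.2))
  (K * M + K * (b - a))).
- by apply: integrable_addr => //; exact: integrable_norm.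
- apply: measurable_funM.
    by apply/measurable_EFinP; exact: measurable_int integrable_comb.
  by apply: (meas_snd (f := fun t => heaviside (t - t1) - heaviside (t - t2)));
    apply: measurable_funB;
    (apply: measurableT_comp; first exact: measurable_heaviside); exact: measurable_funB.
- by move=> n; apply/measurable_EFinP; apply: measurable_int; exact: integrable_addr (iu n) (ig n).
- move=> n p; apply: le_trans (ler_normD _ _) _.
  rewrite [X in _ <= _ * X]ger0_norm ?addr_ge0//.
  apply: le_trans (lerD (bu n p) (bg n p)) _.
  have KM : 0 <= K * M by rewrite mulr_ge0.
  have Kba : 0 <= K * (b - a) by rewrite mulr_ge0.
  move: KM Kba; move: (K * M) (K * (b - a)) => A B A0 B0.
  by rewrite mulrDl lerD// ler_wpM2l// ?lerDl ?lerDr.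
- move=> p; near=> n; rewrite !mulrA -mulrDl.
  have -> : psi n p.2 = heaviside (p.2 - t1) - heaviside (p.2 - t2).
    by congr (_ - _); near: n; exact: near_step.
  congr ((_ * _ + _ * _) * _); near: n; apply: near_comb => z.
    exact: near_dramp.
  exact: near_ramp.
(* The supports of the approximations exceed those of the limits by at most [1/n] on the right,
   which stays inside the open rectangle for large [n]. *)
- pose lo := Num.min x b0; pose hi := Num.max y b1.
  have hib : 0 < b - hi by rewrite subr_gt0 gt_max yb.
  have te : 0 < e - t2 by rewrite subr_gt0.
  near=> n.
  rewrite RintegralD//.
  have Nb : (N n)^-1 < b - hi by near: n; exact: (near_infty_natSinv_lt (PosNum hib)).
  have Ne : (N n)^-1 < e - t2 by near: n; exact: (near_infty_natSinv_lt (PosNum te)).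
  have H1 : smooth (phi n) by exact/smooth_comb/smooth_ramp.
  have H2 (s : R) : is_derive s 1 (phi n) (phi' n s) by exact: is_derive_comb.
  have H3 : smooth (psi n).
    move=> k.
    have -> : psi n = (fun t => step (N n * t + - (N n * t1)) +
        (-1) * step (N n * t + - (N n * t2))).
      by apply/funext => t; rewrite /psi !mulrBr mulN1r.
    apply: smoothkD; first exact/smoothk_affine/smooth_step.
    apply: smoothkM; first exact: smoothk_cst.
    exact/smoothk_affine/smooth_step.
  have N0 : 0 < N n by [].
  have H4 s : ~~ (lo <= s <= hi + (N n)^-1) -> phi n s = 0.
    rewrite negb_and -!ltNge => /orP[|].
      rewrite lt_min => /andP[sx sb0]; rewrite -(comb0 x y b0 b1 s).
      apply: comb_eq => z; rewrite !inE => zk; rewrite ramp_le0 ?ltW// subr_lt0.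
      by case/or4P: zk => /eqP ->//; [exact: lt_trans xy|exact: lt_trans b01].
    move=> his; rewrite -[RHS](@comb_id _ x y b0 b1 s) ?lt_eqF//.
    have yh : y <= hi by rewrite le_max lexx.
    have bh : b1 <= hi by rewrite le_max lexx orbT.
    apply: comb_eq => z; rewrite !inE => zk; rewrite ramp_ge//.
    have zh : z <= hi.
      case/or4P: zk => /eqP -> //; last exact: le_trans (ltW b01) bh.
      exact: le_trans (ltW xy) yh.
    by rewrite lerBrDl; apply: le_trans (ltW his); rewrite lerD2r.
  have H5 t : ~~ (t1 <= t <= t2 + (N n)^-1) -> psi n t = 0.
    rewrite negb_and -!ltNge /psi => /orP[tt1|t2t].
      by rewrite !step_le0 ?subrr// mulr_ge0_le0// ?ltW//; lra.
    have step1 (z : R) : (N n)^-1 <= z -> step (N n * z) = 1.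
      by move=> Nz; rewrite step_ge1// mulrC -ler_pdivrMr// mul1r.
    have t1t : t1 + (N n)^-1 < t by apply: lt_trans t2t; rewrite ltrD2r.
    by rewrite !step1 ?subrr// lerBrDl ltW.
  have alo : a < lo by rewrite lt_min ax.
  have hib' : hi + (N n)^-1 < b by rewrite -ltrBrDl.
  have te' : t2 + (N n)^-1 < e by rewrite -ltrBrDl.
  by rewrite (tw H1 H2 H3 alo hib' ct1 te' H4 H5) addNr.
Unshelve. all: by end_near. Qed.

End knots.
End limit.
End tensor.

Lemma ae_forall_count d (T : measurableType d) (R : realType)
    (mu : {measure set T -> \bar R}) (I : countType) (P : I -> T -> Prop) :
  (forall i, {ae mu, forall x, P i x}) -> {ae mu, forall x, forall i, P i x}.
Proof.
move=> HP.
have : {ae mu, forall x, forall n : nat, if unpickle n is Some i then P i x else True}.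
  apply: ae_foralln => n; case: (@unpickle I n) => [i|]; first exact: HP.
  exact: aeW.
by apply: filterS => x Px i; have := Px (pickle i); rewrite pickleK.
Qed.

Lemma integrable_fubini_G d1 d2 (T1 : measurableType d1) (T2 : measurableType d2)
    (R : realType) (m1 : {sigma_finite_measure set T1 -> \bar R})
    (m2 : {sigma_finite_measure set T2 -> \bar R}) (f : T1 * T2 -> \bar R) :
  (m1 \x m2)%E.-integrable setT f -> m2.-integrable setT (fubini_G m1 f).
Proof.
move=> fi; have mf := measurable_int _ fi.
have mG := measurable_fubini_G fi.
apply/integrableP; split => //.
apply: le_lt_trans ((integrable21ltyP m1 m2 mf).1 fi).
apply: ge0_le_integral => //.
- exact: measurableT_comp.
- by apply: (@measurable_fun_fubini_tonelli_G _ _ _ _ _ m1 (abse \o f)) => //=; exact: measurableT_comp.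
- move=> y _; apply: le_abse_integral => //.
  exact: measurableT_comp mf (pair2_measurable y).
Qed.

Section weak_acl.
Variable R : realType.
Notation mu := (@lebesgue_measure R).

Lemma ae_line_integral0 (h : R * R -> R) (c e : R) :
  (leb2 R).-integrable setT (EFin \o h) ->
  (forall t1 t2, c < t1 -> t1 < t2 -> t2 < e ->
    \int[leb2 R]_p (h p * \1_(`]t1, t2]%classic) p.2) = 0) ->
  {ae mu, forall t, c < t < e -> \int[mu]_s h (s, t) = 0}.
Proof.
move=> hi h0.
pose X t := (\int[mu]_s (h (s, t))%:E)%E.
have iX : mu.-integrable setT X.
  exact: (@integrable_fubini_G _ _ _ _ _ mu mu _ hi).
pose Phi t := fine (X t).
have Xfin : {ae mu, forall t, X t \is a fin_num}.
  have := integrable_ae measurableT iX.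
  by apply: filterS => t; apply.
have iPhi : mu.-integrable setT (EFin \o Phi).
  apply: (le_integrable measurableT _ _ iX).
    apply/measurable_EFinP; apply: measurableT_comp => //.
    exact: measurable_int iX.
  by move=> t _; rewrite /= /Phi; case: (X t) => [r||]//=; rewrite normr0 ?leey.
apply: (zero_integral_ae iPhi) => p q cp pq qe.
have H0 := h0 _ _ cp pq qe; rewrite Rintegral_mkcond.
set A := `]ratr p, ratr q]%classic in H0 *.
have mA : measurable (A : set R) by exact: measurable_itv.
have hA : (leb2 R).-integrable setT (EFin \o (fun p : R * R => h p * \1_A p.2)).
  apply: (le_integrable_scale (M := 1) hi).
    apply: measurable_funM; first by apply/measurable_EFinP; exact: measurable_int hi.
    apply: measurableT_comp; last exact: measurable_snd.
    exact: measurable_indic.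
  move=> x; rewrite mul1r normrM ler_piMr// indicE.
  by case: (_ \in _); rewrite ?normr1 ?normr0.
rewrite -[RHS]H0 /Rintegral; congr fine.
transitivity (\int[mu]_t fubini_G mu (EFin \o (fun p : R * R => h p * \1_A p.2)%R) t)%E;
  last exact: (@integral21_prod_meas1 _ _ _ _ _ mu mu _ hA).
apply: ae_eq_integralT; apply: filterS Xfin; first exact: (ae_filter_ringOfSetsType mu).
move=> t Xt; rewrite patchE /fubini_G /= indicE; case: (t \in A).
  rewrite /Phi fineK// /X; apply: eq_integral => s _.
  by rewrite mulr1.
by rewrite integral0_eq// => s _; rewrite mulr0.
Qed.

Lemma weak_acl (a b c e : R) (u g : R * R -> R) : a < b ->
  (leb2 R).-integrable setT (EFin \o u) -> (leb2 R).-integrable setT (EFin \o g) ->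
  (forall p, ~~ (a <= p.1 <= b) -> g p = 0) ->
  tensor_weak a b c e u g ->
  {ae mu, forall t, c < t < e -> exists U h : R -> R,
    [/\ forall z, 0 <= h z, mu.-integrable setT (EFin \o h),
        integral_modulus a b h U &
        {ae mu, forall s, a < s < b -> u (s, t) = U s}]}.
Proof.
move=> ab ui gi g0 tw.
(* Any two interior points would do as the reference interval with which all others are compared. *)
pose b0 := a + (b - a) / 3; pose b1 := a + 2 * (b - a) / 3.
have ab0 : a < b0 by rewrite /b0; lra.
have b01 : b0 < b1 by rewrite /b0 /b1; lra.
have b1b : b1 < b by rewrite /b1; lra.
(* The pairs of rational knots are countable, so one null set of heights [t] serves for all of
   them. *)
have ae1 : {ae mu, forall t, forall pq : rat * rat,
    a < ratr pq.1 -> ratr pq.1 < ratr pq.2 :> R -> ratr pq.2 < b -> c < t < e ->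
    \int[mu]_s (u (s, t) * comb (ratr pq.1) (ratr pq.2) b0 b1 (@heaviside R) s +
      g (s, t) * comb (ratr pq.1) (ratr pq.2) b0 b1 (@pos_part R) s) = 0}.
  apply: ae_forall_count => -[p q] /=.
  have [/and3P[ap pq qb]|npq] := boolP [&& a < ratr p, ratr p < ratr q :> R & ratr q < b];
    last first.
    by apply: aeW => t ap pq qb; rewrite ap pq qb in npq.
  pose h z := u z * comb (ratr p) (ratr q) b0 b1 (@heaviside R) z.1 +
    g z * comb (ratr p) (ratr q) b0 b1 (@pos_part R) z.1.
  have hi : (leb2 R).-integrable setT (EFin \o h).
    exact: (integrable_comb ui gi g0 pq b01 ap qb ab0 b1b).
  have : {ae mu, forall t, c < t < e -> \int[mu]_s h (s, t) = 0}.
    apply: ae_line_integral0 => // t1 t2 ct1 t12 t2e.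
    rewrite -[RHS](tensor_limit ui gi g0 tw pq b01 ap qb ab0 b1b ct1 t12 t2e).
    by apply: eq_Rintegral => z _; rewrite heavisideB// ltW.
  by apply: filterS; [exact: (ae_filter_ringOfSetsType mu)|move=> t ht _ _ _; exact: ht].
have ae2 := @ae_integrable2 _ _ _ _ _ mu mu _ ui.
have ae3 := @ae_integrable2 _ _ _ _ _ mu mu _ gi.
apply: filterS3 ae1 ae2 ae3; first exact: (ae_filter_ringOfSetsType mu).
move=> t H uti gti cte.
have [|k Hk] := line_acl uti gti ab0 b01 b1b.
  by move=> p q ap pq qb; exact: (H (p, q)).
exists (fun s => k - tail (fun s => g (s, t)) s), (fun s => `|g (s, t)|); split => //.
- exact: integrable_norm gti.
- move=> x y ax xy yb.
  have := tail_modulus gti ax xy yb.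
  by congr (`|_| <= _); ring.
Qed.

End weak_acl.

(** * Constancy on lines *)

Section swap.
Context d1 d2 (T1 : measurableType d1) (T2 : measurableType d2) (R : realType).
Variables (m1 : {sigma_finite_measure set T1 -> \bar R})
          (m2 : {sigma_finite_measure set T2 -> \bar R}).
Local Open Scope ereal_scope.

Lemma measurable_swap : measurable_fun setT (fun p : T2 * T1 => (p.2, p.1)).
Proof. by apply: measurable_fun_pair; [exact: measurable_snd|exact: measurable_fst]. Qed.

Lemma integrable_swap (f : T1 * T2 -> \bar R) : (m1 \x m2).-integrable setT f ->
  (m2 \x m1).-integrable setT (fun p => f (p.2, p.1)).
Proof.
move=> fi; have mf := measurable_int _ fi.
have mfs : measurable_fun setT (fun p : T2 * T1 => f (p.2, p.1)).
  exact: measurableT_comp mf measurable_swap.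
apply/(integrable12ltyP m2 m1 mfs).
exact: ((integrable21ltyP m1 m2 mf).1 fi).
Qed.

Lemma integral_swap (f : T1 * T2 -> \bar R) : (m1 \x m2).-integrable setT f ->
  \int[m2 \x m1]_p f (p.2, p.1) = \int[m1 \x m2]_p f p.
Proof.
move=> fi; rewrite -(integral12_prod_meas1 (integrable_swap fi)).
exact: (integral21_prod_meas1 fi).
Qed.

Lemma product_measure_swap (A : set (T1 * T2)) : measurable A ->
  (m2 \x m1) ((fun p => (p.2, p.1)) @^-1` A) = (m1 \x m2) A.
Proof.
move=> mA; transitivity ((m1 \x^ m2) A).
  rewrite /product_measure1 /product_measure2; apply: eq_integral => y _ /=.
  by congr (m1 _); apply/seteqP; split => x; rewrite /xsection /ysection /= !inE.
apply/esym; apply: product_measure_unique => // B C mB mC.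
by rewrite /= product_measure2E.
Qed.

Lemma ae_xsection (N : set (T1 * T2)) : (m1 \x m2).-negligible N ->
  {ae m1, forall x, m2.-negligible [set y | N (x, y)]}.
Proof.
move=> [A [mA A0 NA]].
have : {ae m1, forall x, setT x -> m2 (xsection A x) = cst 0 x}.
  apply/(ae_eq_integral_abs m1 measurableT); first exact: measurable_fun_xsection.
  rewrite -[RHS]A0; apply: eq_integral => x _.
  by rewrite gee0_abs.
apply: filterS => x /(_ I) A0x.
exists (xsection A x); split => //; first exact: measurable_xsection.
by move=> y Ny; rewrite /xsection/= inE; exact: NA.
Qed.

End swap.

Lemma negligible_swap (R : realType) (N : set (R * R)) : (leb2 R).-negligible N ->
  (leb2 R).-negligible [set p | N (p.2, p.1)].
Proof.
move=> [A [mA A0 NA]]; exists ((fun p => (p.2, p.1)) @^-1` A); split.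
- by rewrite -[X in measurable X]setTI; exact: measurable_swap.
- by rewrite -[RHS]A0; exact: product_measure_swap.
- by move=> p /NA.
Qed.

Section line_constant.
Variables (R : realType) (X : Type) (d : X -> X -> R) (S : set X).
Hypotheses (d0 : forall x y, 0 <= d x y) (Soo : (hausdorff d 2 S < +oo)%E).
Notation mu := (@lebesgue_measure R).
Variables (a b c e : R) (u : R * R -> R) (N : set (R * R))
  (P : R -> R -> R -> X) (w : R -> R -> R -> R).
Hypothesis ab : a < b.
Hypothesis acl : {ae mu, forall t, c < t < e -> exists U h : R -> R,
    [/\ forall z, 0 <= h z, mu.-integrable setT (EFin \o h),
        integral_modulus a b h U &
        {ae mu, forall s, a < s < b -> u (s, t) = U s}]}.
Hypothesis N0 : (leb2 R).-negligible N.
Hypothesis PS : forall s t, a < s < b -> c < t < e -> ~ N (s, t) -> S (P s t (u (s, t))).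
Hypothesis geom : forall K : R, exists2 C, 0 <= C & forall s t z s' t' z' r,
  a < s < b -> a < s' < b -> c < t < e -> c < t' < e -> `|z| <= K -> `|z'| <= K ->
  0 <= r <= 1 -> d (P s t z) (P s' t' z') <= r ->
  `|t - t'| <= C * r /\ (t = t' -> `|w s t z - w s' t z'| <= C * r ^+ 2).
Hypothesis lip : forall K : R, exists2 C, 0 <= C & forall s t z s' z',
  a < s < b -> a < s' < b -> c < t < e -> `|z| <= K -> `|z'| <= K ->
  `|w s t z - w s' t z'| <= C * (`|s - s'| + `|z - z'|).

(** The constants of [geom] depend on a bound for the values of [u], which may be unbounded; hence
    the exhaustion by the sets where [u] is at most [K] in modulus. *)
Let A (K : nat) : set (R * R) := [set p | [/\ a < p.1 < b, c < p.2 < e, ~ N p & `|u p| <= K%:R]].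

Let null_image (K : nat) : {ae mu, forall t,
  mu.-negligible ((fun p => w p.1 p.2 (u p)) @` (A K `&` [set p | p.2 = t]))}.
Proof.
have [C C0 HC] := geom K%:R.
apply: (@negligible_slice_image _ _ d S (A K) (fun p => P p.1 p.2 (u p)) _ C) => //.
  by move=> _ [[s t] [abs cet nN _] <-]; exact: PS.
move=> [s t] [s' t'] r [/= abs cet _ uK] [/= abs' cet' _ uK'] r01 dr.
have [? H] := HC _ _ _ _ _ _ _ abs abs' cet cet' uK uK' r01 dr.
by split=> //= tt'; subst t'; exact: H.
Qed.

(** On a good line [u] agrees almost everywhere with an absolutely continuous [U], and [w] along [U]
    is again absolutely continuous. Its image is covered by the null images of the slices of all
    [A K] and by the image of the null set [N'], which is null by [image_negligible]. So [w] is
    constant there. *)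
Lemma line_constant : {ae mu, forall t, c < t < e ->
  exists k, {ae mu, forall s, a < s < b -> w s t (u (s, t)) = k}}.
Proof.
have aeN : {ae mu, forall t, mu.-negligible [set s | N (s, t)]}.
  have := @ae_xsection _ _ _ _ _ mu mu _ (negligible_swap N0).
  by [].
apply: filterS3 (ae_foralln null_image) aeN acl.
move=> t im Nt acl_t cet; have [U [h [h0 hi hU Uu]]] := acl_t cet.
pose m := (a + b) / 2.
have abm : a < m < b by move: ab; rewrite /m => ?; apply/andP; split; lra.
(* On a single line [U] is bounded, so one constant of [lip] serves along the whole of it. *)
pose B := `|U m| + \int[mu]_z h z.
have hiA (J : set R) : measurable J -> mu.-integrable J (EFin \o h).
  by move=> mJ; exact: integrableS hi.
have UB s : a < s < b -> `|U s| <= B.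
  move=> /andP[as_ sb]; move/andP: (abm) => [am mb].
  have key x y : a < x -> x <= y -> y < b -> `|U y - U x| <= \int[mu]_z h z.
    move=> ax xy yb; apply: le_trans (hU _ _ ax xy yb) _.
    by apply: ge0_subset_Rintegral => //; exact: measurable_itv.
  have : `|U s - U m| <= \int[mu]_z h z.
    have [ms|/ltW sm] := leP m s; first exact: key.
    by rewrite distrC; exact: key.
  by rewrite /B => H; rewrite -(subrK (U m) (U s)) (le_trans (ler_normD _ _))// addrC lerD2l.
have [C C0 HC] := lip B.
pose W s := w s t (U s).
(* The indicator accounts for the direct dependence of [w] on [s], and [h] for the dependence
   through [U]. *)
pose h' z := C * (\1_(`]a, b[%classic) z + h z).
have i1 : mu.-integrable setT (EFin \o (\1_(`]a, b[%classic) : R -> R)).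
  exact: integrable_indic_itv.
have i1h : mu.-integrable setT (EFin \o (fun z => \1_(`]a, b[%classic) z + h z)).
  exact: integrable_addr.
have h'0 z : 0 <= h' z by rewrite mulr_ge0// addr_ge0.
have h'i : mu.-integrable setT (EFin \o h').
  exact: (integrableZl measurableT C i1h).
have Wmod : integral_modulus a b h' W.
  move=> x y ax xy yb.
  have abx : a < x < b by rewrite ax (le_lt_trans xy).
  have aby : a < y < b by rewrite yb (lt_le_trans ax).
  have mJ : measurable (`]x, y[%classic : set R) by exact: measurable_itv.
  rewrite RintegralZl//; last exact: integrableS i1h.
  rewrite RintegralD//; [|exact: integrableS i1|exact: hiA].
  apply: le_trans (HC _ _ _ _ _ aby abx cet (UB _ aby) (UB _ abx)) _.
  rewrite ler_wpM2l// lerD//; last exact: hU.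
  rewrite /Rintegral integral_indic//.
  rewrite (_ : _ `&` _ = `]x, y[%classic); last first.
    apply/seteqP; split => [z []//|z /=]; rewrite !in_itv/= => /andP[xz zy].
    by rewrite xz zy (lt_trans ax)// (lt_trans zy).
  rewrite ger0_norm ?subr_ge0//.
  rewrite [X in fine X]lebesgue_measure_itv/= lte_fin.
  case: ltP => [_|yx]; first by rewrite -EFinB.
  by rewrite subr_le0.
pose N' := [set s | N (s, t)] `|` ~` [set s | a < s < b -> u (s, t) = U s].
have nN' : mu.-negligible N' by apply: negligibleU => //; exact: Nt.
have nW : mu.-negligible (W @` `]a, b[).
  apply: (@negligibleS _ _ _ mu ((W @` (N' `&` `]a, b[)) `|`
     \bigcup_K ((fun p => w p.1 p.2 (u p)) @` (A K `&` [set p | p.2 = t])))).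
    move=> _ [s abs <-].
    have [N's|N's] := pselect (N' s); first by left; exists s.
    right; move: N's => /not_orP[Ns /contrapT uU].
    move: abs; rewrite /= in_itv/= => abs.
    exists (Num.bound `|u (s, t)|) => //; exists (s, t) => /=; last by rewrite /W uU.
    by split => //; split => //=; exact/ltW/archi_boundP.
  apply: negligibleU; first exact: (image_negligible h'0 h'i Wmod nN').
  exact: negligible_bigcup.
exists (W m); apply: filterS Uu; first exact: (ae_filter_ringOfSetsType mu).
move=> s us abs; rewrite us//.
exact: (negligible_image_constant h'0 h'i Wmod nW).
Qed.

End line_constant.

(** * The contradiction between the two families of lines *)

Lemma normr_itv_le (R : realDomainType) (a b x : R) :
  a < x < b -> `|x| <= `|a| + `|b|.
Proof.
move=> /andP[ax xb]; rewrite ler_norml; apply/andP; split.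
  by have := lerNnormlW (lexx `|a|); have := normr_ge0 b; lra.
by have := ler_norm b; have := normr_ge0 a; lra.
Qed.

Section weights.
Variable R : realType.
Notation mu := (@lebesgue_measure R).

Lemma not_negligible_itv (a b : R) (Z : set R) : a < b -> mu.-negligible Z ->
  exists2 x, a < x < b & ~ Z x.
Proof.
move=> ab nZ; apply: contrapT => H.
have sub : `]a, b[ `<=` Z.
  move=> x /=; rewrite in_itv/= => abx; apply: contrapT => Zx.
  by apply: H; exists x.
have := @negligibleS _ _ _ mu _ _ sub nZ.
move/(@measure_negligible _ _ _ mu _ (measurable_itv _)).
rewrite [LHS]lebesgue_measure_itv/= lte_fin ab -EFinD => -[] /eqP.
by rewrite subr_eq0 gt_eqF.
Qed.

Lemma integrable_itv_support (a b M : R) (p : R -> R) : measurable_fun setT p ->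
  (forall x, `|p x| <= M) -> (forall x, ~~ (a < x < b) -> p x = 0) ->
  mu.-integrable setT (EFin \o p).
Proof.
move=> mp pM p0.
have i1 : mu.-integrable setT (EFin \o (\1_(`]a, b[%classic) : R -> R)).
  exact: integrable_indic_itv.
apply: (le_integrable_scale (M := M) i1) => // x.
have [abx|nabx] := boolP (a < x < b).
  by rewrite indicE mem_set ?normr1 ?mulr1//= in_itv.
by rewrite p0// normr0 mulr_ge0// (le_trans _ (pM 0)).
Qed.

(* p = f - (mean of f) on ]a, b[ : the integral of p * f is that of p ^ 2. *)
Lemma weight_exists (a b M : R) (f : R -> R) : a < b ->
  measurable_fun `]a, b[ f -> (forall x, a < x < b -> `|f x| <= M) ->
  (forall x y, a < x < b -> a < y < b -> f x = f y -> x = y) ->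
  exists (p : R -> R) (M' : R),
    [/\ measurable_fun setT p, forall x, `|p x| <= M',
        forall x, ~~ (a < x < b) -> p x = 0,
        \int[mu]_x p x = 0 & \int[mu]_x (p x * f x) != 0].
Proof.
move=> ab mf fM finj.
pose f0 := f \_ `]a, b[.
have f0E x : a < x < b -> f0 x = f x by move=> abx; rewrite /f0 patchE mem_set//= in_itv.
have f00 x : ~~ (a < x < b) -> f0 x = 0.
  by move=> abx; rewrite /f0 patchE memNset//= in_itv/=; exact/negP.
have mf0 : measurable_fun setT f0.
  by apply: (@proj1 _ _ (@measurable_restrictT _ _ _ _ `]a, b[%classic f _) mf); exact: measurable_itv.
have M0 : 0 <= M.
  have abm : a < (a + b) / 2 < b by apply/andP; split; lra.
  exact: le_trans (fM _ abm).
have f0M x : `|f0 x| <= M.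
  by have [abx|abx] := boolP (a < x < b); [rewrite f0E ?fM|rewrite f00 ?normr0].
have if0 := integrable_itv_support mf0 f0M f00.
pose J : R -> R := \1_(`]a, b[%classic).
have mJ : measurable_fun setT J by apply: measurable_indic; exact: measurable_itv.
have iJ : mu.-integrable setT (EFin \o J) by exact: integrable_indic_itv.
have JE x : J x = if a < x < b then 1 else 0.
  rewrite /J indicE; case: ifPn => abx; first by rewrite mem_set//= in_itv.
  by rewrite memNset//= in_itv/=; exact/negP.
pose k := (\int[mu]_x f0 x) / (b - a).
pose p x := f0 x - k * J x.
have mp : measurable_fun setT p by apply: measurable_funB => //; exact: measurable_funM.
have pM x : `|p x| <= M + `|k|.
  apply: le_trans (ler_normB _ _) _; apply: lerD => //.
  rewrite normrM ler_piMr// JE; case: ifP; rewrite ?normr1 ?normr0//.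
have p0 x : ~~ (a < x < b) -> p x = 0.
  by move=> abx; rewrite /p f00// JE (negbTE abx) mulr0 subr0.
have ip := integrable_itv_support mp pM p0.
have intJ : \int[mu]_x J x = b - a.
  rewrite /Rintegral integral_indic//.
  by rewrite setIT [X in fine X]lebesgue_measure_itv/= lte_fin ab -EFinB.
have intp : \int[mu]_x p x = 0.
  rewrite /p RintegralB//; last exact: (integrableZl measurableT k iJ).
  by rewrite RintegralZl// intJ /k divfK ?subrr// subr_eq0 gt_eqF.
exists p, (M + `|k|); split => //.
have i2 : mu.-integrable setT (EFin \o (fun x => p x * p x)).
  apply: (le_integrable_scale ip _ (M := M + `|k|)); first exact: measurable_funM.
  by move=> x; rewrite normrM ler_wpM2r.
have -> : \int[mu]_x (p x * f x) = \int[mu]_x (p x * p x).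
  transitivity (\int[mu]_x (p x * p x + k * p x)).
    apply: eq_Rintegral => x _.
    have [abx|abx] := boolP (a < x < b); last by rewrite p0// !mul0r mulr0 addr0.
    by rewrite {3}/p JE abx f0E//; ring.
  rewrite RintegralD//; last exact: (integrableZl measurableT k ip).
  by rewrite RintegralZl// intp mulr0 addr0.
(* If the integral of [p ^+ 2] vanished, [f] would equal its mean almost everywhere; the two halves
   of the interval then supply two distinct points with equal values, against injectivity. *)
apply/eqP => pp0.
have : ae_eq mu setT (EFin \o (fun x => p x * p x)) (cst 0%E).
  apply/(ae_eq_integral_abs mu measurableT); first exact: measurable_int i2.
  rewrite (_ : (fun x => _) = (fun x => (p x * p x)%:E)); last first.
    by apply/funext => x; rewrite gee0_abs// lee_fin -expr2 sqr_ge0.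
  by rewrite -[LHS]fineK ?[fine _]pp0//; exact: integrable_fin_num i2.
move=> [Z [mZ Z0 subZ]].
have nZ : mu.-negligible (~` [set x | p x * p x = 0]).
  exists Z; split => // x px; apply: subZ => /= /(_ I) [] H; exact: px.
have fk x : a < x < b -> ~ (~` [set x | p x * p x = 0]) x -> f x = k.
  move=> abx /contrapT/= /eqP; rewrite mulf_eq0 orbb /p JE abx f0E// mulr1 subr_eq0.
  by move/eqP.
pose mid := (a + b) / 2.
have amid : a < mid by rewrite /mid; lra.
have midb : mid < b by rewrite /mid; lra.
have [x /andP[ax xm] Zx] := not_negligible_itv amid nZ.
have [y /andP[my yb] Zy] := not_negligible_itv midb nZ.
have abx : a < x < b by rewrite ax (lt_trans xm).
have aby : a < y < b by rewrite yb (lt_trans amid).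
have xy : x = y by apply: finj => //; rewrite !fk.
by have := lt_trans xm my; rewrite xy ltxx.
Qed.

(** Integrate [v] against [p s * q t], with [p] and [q] of mean zero. In [s] first, [v] is constant
    on lines and the result is 0. In [t] first, the constant part again disappears, and [t * m s]
    leaves the integral of [q t * t] times that of [p s * m s]; [weight_exists] makes both factors
    nonzero. *)
Lemma lines_contradiction (a b c e M : R) (v : R * R -> R) (m : R -> R) :
  a < b -> c < e -> (leb2 R).-integrable setT (EFin \o v) ->
  measurable_fun `]a, b[ m -> (forall x, a < x < b -> `|m x| <= M) ->
  (forall x y, a < x < b -> a < y < b -> m x = m y -> x = y) ->
  {ae mu, forall t, c < t < e ->
     exists k, {ae mu, forall s, a < s < b -> v (s, t) = k}} ->
  {ae mu, forall s, a < s < b ->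
     exists k, {ae mu, forall t, c < t < e -> v (s, t) - t * m s = k}} ->
  False.
Proof.
move=> ab ce vi mm mM minj H1 H2.
have [p [Mp [mp pM p0 intp pm]]] := weight_exists ab mm mM minj.
have [|||q [Mq [mq qM q0 intq qt]]] := @weight_exists c e (`|c| + `|e|) id ce.
- by [].
- by move=> x; exact: normr_itv_le.
- by [].
have ip := integrable_itv_support mp pM p0.
have iq := integrable_itv_support mq qM q0.
pose k (z : R * R) := v z * (p z.1 * q z.2).
have Mp0 : 0 <= Mp by apply: le_trans (pM 0).
have ki : (leb2 R).-integrable setT (EFin \o k).
  apply: (le_integrable_scale (M := Mp * Mq) vi).
    apply: measurable_funM; first by apply/measurable_EFinP; exact: measurable_int vi.
    by apply: measurable_funM; [exact: (measurableT_comp mp measurable_fst)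
                               |exact: (measurableT_comp mq measurable_snd)].
  by move=> z; rewrite normrM mulrC ler_wpM2r// normrM ler_pM.
have E1 : (\int[leb2 R]_z (k z)%:E = 0)%E.
  rewrite -[LHS](@integral21_prod_meas1 _ _ _ _ _ mu mu _ ki).
  rewrite (@ae_eq_integralT _ _ _ mu _ (fun=> 0%E)) ?integral0//.
  apply: filterS H1; first exact: (ae_filter_ringOfSetsType mu).
  move=> t Ht; rewrite /fubini_G /=.
  have [/Ht[kt Hkt]|nt] := boolP (c < t < e); last first.
    by rewrite integral0_eq// => s _; rewrite /k /= q0// !mulr0.
  rewrite (@ae_eq_integralT _ _ _ mu _ (fun s => ((kt * q t) * p s)%:E)).
    under eq_integral do rewrite EFinM.
    rewrite integralZl//; rewrite -[X in (_ * X)%E]fineK ?integrable_fin_num//.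
    by rewrite [fine _]intp mule0.
  apply: filterS Hkt; first exact: (ae_filter_ringOfSetsType mu).
  move=> s Hs; rewrite /k /=.
  have [/Hs ->|ns] := boolP (a < s < b); first by congr EFin; ring.
  by rewrite p0// !(mul0r, mulr0).
pose Cq := \int[mu]_t (q t * t).
have iqt : mu.-integrable setT (EFin \o (fun t => q t * t)).
  apply: (le_integrable_scale (M := `|c| + `|e|) iq).
    exact: measurable_funM.
  move=> t; have [cte|nt] := boolP (c < t < e); last by rewrite q0// mul0r normr0 mulr0.
  by rewrite normrM mulrC ler_wpM2r// normr_itv_le.
have E2 : (\int[leb2 R]_z (k z)%:E = \int[mu]_s (Cq * (p s * m s))%:E)%E.
  rewrite -[LHS](@integral12_prod_meas1 _ _ _ _ _ mu mu _ ki).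
  apply: ae_eq_integralT.
  apply: filterS H2; first exact: (ae_filter_ringOfSetsType mu).
  move=> s Hs; rewrite /fubini_F /=.
  have [/Hs[ks Hks]|ns] := boolP (a < s < b); last first.
    by rewrite integral0_eq// => [|t _]; rewrite /k /= p0// !(mul0r, mulr0).
  have i1 : mu.-integrable setT (EFin \o (fun t => (ks * p s) * q t)).
    exact: (integrableZl measurableT (ks * p s) iq).
  have i2 : mu.-integrable setT (EFin \o (fun t => (p s * m s) * (q t * t))).
    exact: (integrableZl measurableT (p s * m s) iqt).
  rewrite (@ae_eq_integralT _ _ _ mu _
    (fun t => ((ks * p s) * q t + (p s * m s) * (q t * t))%:E)).
    rewrite -[LHS]fineK; last exact: integrable_fin_num (integrable_addr measurableT i1 i2).
    congr EFin; rewrite -/(Rintegral mu setT (fun t => ((ks * p s) * q t + (p s * m s) * (q t * t)))).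
    rewrite RintegralD// !RintegralZl// intq mulr0 add0r -/Cq; ring.
  apply: filterS Hks; first exact: (ae_filter_ringOfSetsType mu).
  move=> t Ht; rewrite /k /=; have [/Ht <-|nt] := boolP (c < t < e).
    by congr EFin; ring.
  by rewrite q0// !(mul0r, mulr0) addr0.
have ipm : mu.-integrable setT (EFin \o (fun s => p s * m s)).
  apply: (le_integrable_scale (M := M) ip).
    rewrite (_ : (fun s => _) = (fun s => p s * (m \_ `]a, b[) s)); last first.
      apply/funext => s; rewrite patchE; case: ifPn => //.
      by rewrite notin_setE/= in_itv/= => /negP/p0 ->; rewrite !mul0r.
    apply: measurable_funM => //.
    by apply: (@proj1 _ _ (@measurable_restrictT _ _ _ _ `]a, b[%classic m _) mm); exact: measurable_itv.
  move=> s; have [abs|/p0 ->] := boolP (a < s < b); last by rewrite mul0r normr0 mulr0.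
  by rewrite normrM mulrC ler_wpM2r// mM.
move: E2; rewrite E1 => /(congr1 fine) /=.
rewrite -/(Rintegral mu setT (fun s => Cq * (p s * m s))) RintegralZl// => /esym/eqP.
by rewrite mulf_eq0 (negbTE pm) orbF (negbTE qt).
Qed.

End weights.

(** * Homogeneous distances and coordinates *)

Section metric.
Variables (R : realType) (d : R * R * R -> R * R * R -> R).
Hypothesis hd : homogeneous_distance d.

(** By left invariance it is enough to treat the distance to the origin. It has a positive lower
    bound [m] on the compact unit sphere of the sup norm, and dilations carry the bound to all
    points. The third estimate concerns the third coordinate of the quotient of the two points, and
    is quadratic because dilations scale that coordinate quadratically. *)
Lemma hdist_coord_bounds : exists2 C, 0 < C & forall x y r, d x y <= r ->
  [/\ `|x.1.1 - y.1.1| <= C * r, `|x.1.2 - y.1.2| <= C * r &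
      `|y.2 - x.2 - (x.1.1 * y.1.2 - x.1.2 * y.1.1)| <= C * r ^+ 2].
Proof.
pose o : R * R * R := (0, 0, 0).
pose f z := d o z.
have cf : continuous f.
  move=> z; have cp := hdist_continuous hd.
  have := @continuous_comp _ _ _ (fun z => (o, z)) (fun p => d p.1 p.2) z.
  apply; last exact: cp.
  exact: (@cvg_pair _ _ _ (nbhs z) (nbhs o) (nbhs z) _ _ _ (fun=> o) id (cvg_cst o) cvg_id).
pose S := [set z : R * R * R | `|z| = 1].
have cS : compact S.
  have I1 : compact (`[-1, 1] : set R) by exact: segment_compact.
  have I3 : compact ((`[-1, 1] `*` `[-1, 1]) `*` `[-1, 1] : set (R * R * R)).
    by apply: compact_setX => //; exact: compact_setX.
  apply: (subclosed_compact _ I3).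
  - have -> : S = (fun z => `|z|) @^-1` [set 1 : R] by [].
    by apply: preimage_closed; [move=> z _; exact: norm_continuous|exact: closed_eq].
  - move=> [[z1 z2] z3] /=; rewrite /S /= !prod_normE /= => zS.
    have := lexx (1 : R); rewrite -{1}zS !ge_max => /andP[/andP[h1 h2] h3].
    by rewrite !in_itv/= -!ler_norml.
have [m m0 fm] : exists2 m, 0 < m & forall z, S z -> m <= f z.
  have : closed (f @` S).
    apply: compact_closed; first exact: Rhausdorff.
    by apply: continuous_compact => //; apply: continuous_subspaceT.
  move=> /closed_openC; rewrite openE => /(_ 0).
  have nS : (~` (f @` S)) 0.
    move=> [z Sz /(hdist_eq0 hd) zo]; move: Sz; rewrite -zo /S/= !prod_normE/= normr0 !maxxx.
    by move=> /esym/eqP; rewrite oner_eq0.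
  move=> /(_ nS) /nbhs_ballP[m /= m0 mS]; exists m => // z Sz.
  rewrite leNgt; apply/negP => zm; apply: (mS (f z)); last by exists z.
  by rewrite /ball/= sub0r normrN ger0_norm// (hdist_ge0 hd).
have key z r : f z <= r -> [/\ `|z.1.1| <= m^-1 * r, `|z.1.2| <= m^-1 * r & `|z.2| <= (m^-1 * r) ^+ 2].
  move=> fr; have r0 : 0 <= r by apply: le_trans fr; exact: hdist_ge0.
  have mr0 : 0 <= m^-1 * r by rewrite mulr_ge0// invr_ge0 ltW.
  (* A homogeneous gauge: if it is positive, the dilation by [q^-1] brings [z] to the unit
     sphere. *)
  pose q := Num.max (Num.max `|z.1.1| `|z.1.2|) (Num.sqrt `|z.2|).
  have q0 : 0 <= q by rewrite !le_max normr_ge0.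
  have q1 : `|z.1.1| <= q by rewrite !le_max lexx.
  have q2 : `|z.1.2| <= q by rewrite !le_max lexx orbT.
  have q3 : `|z.2| <= q ^+ 2.
    by rewrite -[leLHS]sqr_sqrtr// ler_sqr ?nnegrE ?sqrtr_ge0// /q le_max lexx orbT.
  suff qr : q <= m^-1 * r.
    split; [exact: le_trans qr|exact: le_trans qr|apply: le_trans q3 _].
    by rewrite ler_sqr.
  move: q0; rewrite le_eqVlt => /predU1P[<-//|q0].
  pose z' : R * R * R := (q^-1 * z.1.1, q^-1 * z.1.2, (q ^+ 2)^-1 * z.2).
  have zz' : z = heis_dil q z'.
    have qn0 : q != 0 by rewrite gt_eqF.
    rewrite /heis_dil /z' /= !mulrA !mulfV ?expf_neq0// !mul1r.
    by case: (z) => -[].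
  have Sz' : S z'.
    rewrite /S /z' /= !prod_normE /= !normrM !normfV normrX [`|q|]gtr0_norm//.
    apply/eqP; rewrite eq_le !ge_max; apply/andP; split.
      by rewrite !ler_pdivrMl ?exprn_gt0// !mulr1 q1 q2 q3.
    rewrite !le_max.
    have : q \in [:: `|z.1.1|; `|z.1.2|; Num.sqrt `|z.2|].
      by rewrite /q /Num.max; case: ifP => _; [|case: ifP => _]; rewrite !inE eqxx ?orbT.
    rewrite !inE => /or3P[] /eqP e.
    - by rewrite -e mulVf ?lexx// gt_eqF.
    - by rewrite -e mulVf ?lexx ?orbT// gt_eqF.
    - by rewrite {1 3}e sqr_sqrtr// mulVf ?lexx ?orbT// -[`|_|]sqr_sqrtr// -e sqrf_eq0 gt_eqF.
  have fz : f z = q * f z'.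
    rewrite /f zz' -(hdist_homogeneous hd)//; congr d.
    by rewrite /heis_dil/= !mulr0.
  by rewrite ler_pdivlMl// mulrC; apply: le_trans fr; rewrite fz ler_wpM2l ?fm// ltW.
(* The horizontal bounds need [m^-1], the vertical one its square. *)
exists (Num.max m^-1 (m^-1 ^+ 2)); first by rewrite lt_max invr_gt0 m0.
move=> x y r dr; have r0 : 0 <= r by apply: le_trans dr; exact: hdist_ge0.
(* The group quotient of [y] by [x] on the left; inverses in this group are opposites. *)
pose z : R * R * R := (y.1.1 - x.1.1, y.1.2 - x.1.2, y.2 - x.2 - (x.1.1 * y.1.2 - x.1.2 * y.1.1)).
have fz : f z <= r.
  rewrite /f; have -> : o = heis_mul (- x.1.1, - x.1.2, - x.2) x.
    by rewrite /heis_mul /=; congr (_, _, _); ring.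
  have -> : z = heis_mul (- x.1.1, - x.1.2, - x.2) y.
    by rewrite /heis_mul /z /=; congr (_, _, _); ring.
  by rewrite (hdist_left_invariant hd).
have [/= h1 h2 h3] := key _ _ fz.
split.
- by rewrite distrC; apply: le_trans h1 _; rewrite ler_wpM2r// le_max lexx.
- by rewrite distrC; apply: le_trans h2 _; rewrite ler_wpM2r// le_max lexx.
- by apply: le_trans h3 _; rewrite exprMn ler_wpM2r ?sqr_ge0// le_max lexx orbT.
Qed.

End metric.

(** * Test functions of product type *)

Section test_functions.
Variable R : realType.
Implicit Types (f g : R -> R).

Lemma is_derive_tensor1 f f' g (p : R * R) : (forall x : R, is_derive x 1 f (f' x)) ->
  is_derive p (1, 0) (fun p : R * R => f p.1 * g p.2) (f' p.1 * g p.2).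
Proof.
move=> df; have [dfp e] := df p.1.
have L : h^-1 *: ((f \o shift p.1) (h *: 1) - f p.1) @[h --> 0^'] --> f' p.1.
  by rewrite -e; exact: dfp.
have L2 : h^-1 *: (((fun p : R * R => f p.1 * g p.2) \o shift p) (h *: (1, 0)) - f p.1 * g p.2)
    @[h --> 0^'] --> f' p.1 * g p.2.
  rewrite (_ : (fun h => _) =
    (fun h => h^-1 *: ((f \o shift p.1) (h *: 1) - f p.1) * g p.2)).
    by apply: cvgM => //; exact: cvg_cst.
  apply/funext => h /=; rewrite [h *: 0]mulr0 add0r -![_ *: _]/(_ * _) -mulrBl; ring.
by apply: DeriveDef; [exact: (cvgP _ L2)|exact: (cvg_lim _ L2)].
Qed.

Lemma is_derive_tensor2 f g g' (p : R * R) : (forall x : R, is_derive x 1 g (g' x)) ->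
  is_derive p (0, 1) (fun p : R * R => f p.1 * g p.2) (f p.1 * g' p.2).
Proof.
move=> dg; have [dgp e] := dg p.2.
have L : h^-1 *: ((g \o shift p.2) (h *: 1) - g p.2) @[h --> 0^'] --> g' p.2.
  by rewrite -e; exact: dgp.
have L2 : h^-1 *: (((fun p : R * R => f p.1 * g p.2) \o shift p) (h *: (0, 1)) - f p.1 * g p.2)
    @[h --> 0^'] --> f p.1 * g' p.2.
  rewrite (_ : (fun h => _) =
    (fun h => f p.1 * (h^-1 *: ((g \o shift p.2) (h *: 1) - g p.2)))).
    by apply: cvgM => //; exact: cvg_cst.
  apply/funext => h /=; rewrite [h *: 0]mulr0 add0r -![_ *: _]/(_ * _) -mulrBr; ring.
by apply: DeriveDef; [exact: (cvgP _ L2)|exact: (cvg_lim _ L2)].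
Qed.

Lemma Ck_tensor k f g : smooth f -> smooth g -> Ck k (fun p : R * R => f p.1 * g p.2).
Proof.
have ct f1 g1 : smooth f1 -> smooth g1 -> continuous (fun p : R * R => f1 p.1 * g1 p.2).
  move=> /smooth_continuous cf /smooth_continuous cg p; apply: continuousM.
    by apply: continuous_comp; [exact: cvg_fst|exact: cf].
  by apply: continuous_comp; [exact: cvg_snd|exact: cg].
elim: k f g => [|k IH] f g sf sg; first exact: ct.
have [f' df sf'] := smooth_is_derive sf; have [g' dg sg'] := smooth_is_derive sg.
have E1 : (fun x : R * R => 'D_(1, 0) (fun p : R * R => f p.1 * g p.2) x) =
    (fun p => f' p.1 * g p.2).
  by apply/funext => p; case: (is_derive_tensor1 g p df).
have E2 : (fun x : R * R => 'D_(0, 1) (fun p : R * R => f p.1 * g p.2) x) =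
    (fun p => f p.1 * g' p.2).
  by apply/funext => p; case: (is_derive_tensor2 f p dg).
split; [exact: ct| |rewrite E1; exact: IH|rewrite E2; exact: IH].
by split=> p; [case: (is_derive_tensor1 g p df)|case: (is_derive_tensor2 f p dg)].
Qed.

Lemma test_function_tensor f g (a1 b1 c1 e1 : R) (D : set (R * R)) :
  smooth f -> smooth g ->
  (forall s, ~~ (a1 <= s <= b1) -> f s = 0) -> (forall t, ~~ (c1 <= t <= e1) -> g t = 0) ->
  `[a1, b1] `*` `[c1, e1] `<=` D ->
  test_function D (fun p : R * R => f p.1 * g p.2).
Proof.
move=> sf sg f0 g0 QD.
have cQ : compact (`[a1, b1] `*` `[c1, e1] : set (R * R)).
  by apply: compact_setX; exact: segment_compact.
have clQ : closed (`[a1, b1] `*` `[c1, e1] : set (R * R)).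
  by apply: compact_closed cQ; exact: norm_hausdorff.
have suppQ : closure [set x : R * R | f x.1 * g x.2 != 0] `<=` `[a1, b1] `*` `[c1, e1].
  rewrite closureE => p; apply; split => // -[s t] /= /eqP st.
  rewrite !in_itv/=; split; apply/negPn/negP => H; apply: st.
    by rewrite f0// mul0r.
  by rewrite g0// mulr0.
split; first by move=> k; exact: Ck_tensor.
  by apply: (subclosed_compact _ cQ suppQ); exact: closed_closure.
exact: subset_trans suppQ QD.
Qed.

Lemma derive_support f f' (a1 b1 : R) : (forall x : R, is_derive x 1 f (f' x)) ->
  (forall s, ~~ (a1 <= s <= b1) -> f s = 0) -> forall s, ~~ (a1 <= s <= b1) -> f' s = 0.
Proof.
move=> df f0 s ns; have [_ <-] := df s.
rewrite (@near_eq_derive _ _ _ _ (cst 0)) ?derive_cst//.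
move: ns; rewrite negb_and -!ltNge => /orP[sa|bs].
  near=> z; rewrite f0//= negb_and -ltNge; apply/orP; left.
  by near: z; exact: lt_nbhsl.
near=> z; rewrite f0//= negb_and -!ltNge; apply/orP; right.
by near: z; exact: lt_nbhsr.
Unshelve. all: by end_near. Qed.

Lemma continuous_support_bounded f (a1 b1 : R) : continuous f ->
  (forall s, ~~ (a1 <= s <= b1) -> f s = 0) -> exists M, forall s, `|f s| <= M.
Proof.
move=> cf f0; have [ab|ba] := leP a1 b1; last first.
  by exists 0 => s; rewrite f0 ?normr0//; apply/negP => /andP[sa sb]; move: ba; rewrite ltNge (le_trans sa).
have [y _ yM] := @EVT_max R (fun y => `|f y|) a1 b1 ab
    (continuous_subspaceT (fun y => continuous_comp (cf y) (@norm_continuous _ _ _))).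
exists `|f y| => s; have [sab|/f0 ->] := boolP (a1 <= s <= b1); last by rewrite normr0.
by apply: yM; rewrite in_itv.
Qed.

Lemma Rintegral_swap_tensor (u : R * R -> R) f g Mf Mg :
  (leb2 R).-integrable setT (EFin \o u) -> continuous f -> continuous g ->
  (forall s, `|f s| <= Mf) -> (forall s, `|g s| <= Mg) ->
  \int[leb2 R]_p (u (p.2, p.1) * (f p.1 * g p.2)) =
  \int[leb2 R]_p (u p * (g p.1 * f p.2)).
Proof.
move=> ui cf cg fM gM; congr fine.
have mf : measurable_fun setT f by exact: continuous_measurable_fun.
have mg : measurable_fun setT g by exact: continuous_measurable_fun.
have hi : (leb2 R).-integrable setT (EFin \o (fun p : R * R => u p * (g p.1 * f p.2))).
  apply: (le_integrable_scale (M := Mg * Mf) ui).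
    apply: measurable_funM; first by apply/measurable_EFinP; exact: measurable_int ui.
    by apply: measurable_funM; [exact: (measurableT_comp mg measurable_fst)
                               |exact: (measurableT_comp mf measurable_snd)].
  by move=> p; rewrite normrM mulrC ler_wpM2r// normrM ler_pM.
rewrite -[RHS](@integral_swap _ _ _ _ _ (@lebesgue_measure R) (@lebesgue_measure R) _ hi).
by apply: eq_integral => p _ /=; rewrite [f _ * _]mulrC.
Qed.

(** The Borel representative, cut off to a compact rectangle, is integrable on the whole plane,
    where Fubini applies. *)
Lemma L1loc_rect (D : set (R * R)) (f : R * R -> R) (a b c e : R) :
  L1loc D f -> `[a, b] `*` `[c, e] `<=` D ->
  exists2 f0 : R * R -> R, (leb2 R).-integrable setT (EFin \o f0) &
    (forall p, ~ (`[a, b] `*` `[c, e]) p -> f0 p = 0) /\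
    {ae leb2 R, forall p, (`[a, b] `*` `[c, e]) p -> f p = f0 p}.
Proof.
set Q : set (R * R) := `[a, b] `*` `[c, e].
move=> [g [_ fg gi]] QD; exists (g \_ Q).
  rewrite -restrict_EFin.
  apply: (@proj1 _ _ (@integrable_mkcond _ _ _ (leb2 R) Q _ _)).
    by apply: measurableX; exact: measurable_itv.
  by apply: gi => //; apply: compact_setX; exact: segment_compact.
split=> [p Qp|]; first by rewrite patchE memNset.
apply: filterS fg; first exact: (ae_filter_ringOfSetsType (leb2 R)).
by move=> p fgp Qp; rewrite patchE mem_set// fgp//; exact: QD.
Qed.

Section weak.
Variables (D : set (R * R)) (u g : R * R -> R) (a b c e : R).
Let Q : set (R * R) := `[a, b] `*` `[c, e].
Hypothesis QD : Q `<=` D.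
Variables (u0 g0 : R * R -> R).
Hypotheses (u00 : forall p, ~ Q p -> u0 p = 0) (g00 : forall p, ~ Q p -> g0 p = 0)
  (uu0 : {ae leb2 R, forall p, Q p -> u p = u0 p})
  (gg0 : {ae leb2 R, forall p, Q p -> g p = g0 p}).

Let QE s t : Q (s, t) <-> a <= s <= b /\ c <= t <= e.
Proof. by rewrite /Q/= !in_itv/=. Qed.

Let Rintegral_supp (h h0 k : R * R -> R) :
  (forall p, ~ Q p -> h0 p = 0) -> {ae leb2 R, forall p, Q p -> h p = h0 p} ->
  (forall p, ~ Q p -> k p = 0) ->
  \int[leb2 R]_(p in D) (h p * k p) = \int[leb2 R]_p (h0 p * k p).
Proof.
move=> h00 hh0 k0; rewrite Rintegral_mkcond; apply: ae_eq_RintegralT.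
apply: filterS hh0; first exact: (ae_filter_ringOfSetsType (leb2 R)).
move=> p hp; rewrite patchE.
have [Qp|Qp] := pselect (Q p); last by rewrite k0// !mulr0 if_same.
by rewrite mem_set ?hp//; exact: QD.
Qed.

Lemma weak_derivative_tensor1 : weak_derivative D (1, 0) u g ->
  tensor_weak a b c e u0 g0.
Proof.
move=> wd f f' psi a1 b1 c1 e1 sf df spsi aa1 b1b cc1 e1e f0 psi0.
have fout s : ~~ (a <= s <= b) -> ~~ (a1 <= s <= b1).
  by apply: contra => /andP[? ?]; apply/andP; split; lra.
have pout t : ~~ (c <= t <= e) -> ~~ (c1 <= t <= e1).
  by apply: contra => /andP[? ?]; apply/andP; split; lra.
have kout (f1 g1 : R -> R) : (forall s, ~~ (a1 <= s <= b1) -> f1 s = 0) ->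
    (forall t, ~~ (c1 <= t <= e1) -> g1 t = 0) ->
    forall p, ~ Q p -> f1 p.1 * g1 p.2 = 0.
  move=> f10 g10 [s t] /QE/not_andP[|] /negP ns /=.
    by rewrite f10 ?mul0r//; exact: fout.
  by rewrite g10 ?mulr0//; exact: pout.
have tf : test_function D (fun p : R * R => f p.1 * psi p.2).
  apply: (test_function_tensor sf spsi f0 psi0) => -[s t] /=.
  rewrite !in_itv/= => -[/andP[? ?] /andP[? ?]]; apply: QD; apply/QE.
  by split; apply/andP; split; lra.
have := wd _ tf.
rewrite (_ : (fun p => u p * _) = (fun p => u p * (f' p.1 * psi p.2))); last first.
  by apply/funext => p; case: (is_derive_tensor1 psi p df) => _ ->.
rewrite (Rintegral_supp u00 uu0) ?(Rintegral_supp g00 gg0)//.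
  exact: kout.
by apply: kout => //; exact: derive_support df f0.
Qed.

(** Exchanging the coordinates reduces the lines [s = const] to the case of the derivative in the
    first variable. *)
Lemma weak_derivative_tensor2 :
  (leb2 R).-integrable setT (EFin \o u0) -> (leb2 R).-integrable setT (EFin \o g0) ->
  weak_derivative D (0, 1) u g ->
  tensor_weak c e a b (fun p => u0 (p.2, p.1)) (fun p => g0 (p.2, p.1)).
Proof.
move=> u0i g0i wd f f' psi a1 b1 c1 e1 sf df spsi aa1 b1b cc1 e1e f0 psi0.
have fout s : ~~ (c <= s <= e) -> ~~ (a1 <= s <= b1).
  by apply: contra => /andP[? ?]; apply/andP; split; lra.
have pout t : ~~ (a <= t <= b) -> ~~ (c1 <= t <= e1).
  by apply: contra => /andP[? ?]; apply/andP; split; lra.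
have kout (f1 g1 : R -> R) : (forall s, ~~ (a1 <= s <= b1) -> f1 s = 0) ->
    (forall t, ~~ (c1 <= t <= e1) -> g1 t = 0) ->
    forall p, ~ Q p -> g1 p.1 * f1 p.2 = 0.
  move=> f10 g10 [s t] /QE/not_andP[|] /negP ns /=.
    by rewrite g10 ?mul0r//; exact: pout.
  by rewrite f10 ?mulr0//; exact: fout.
have tf : test_function D (fun p : R * R => psi p.1 * f p.2).
  apply: (test_function_tensor spsi sf psi0 f0) => -[s t] /=.
  rewrite !in_itv/= => -[/andP[? ?] /andP[? ?]]; apply: QD; apply/QE.
  by split; apply/andP; split; lra.
have := wd _ tf.
rewrite (_ : (fun p => u p * _) = (fun p => u p * (psi p.1 * f' p.2))); last first.
  by apply/funext => p; case: (is_derive_tensor2 psi p df) => _ ->.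
rewrite (Rintegral_supp u00 uu0) ?(Rintegral_supp g00 gg0)//; last first.
- by apply: kout => //; exact: derive_support df f0.
- exact: kout.
have cf' : continuous f' by exact/smooth_continuous/(smooth_derive df).
have cf := smooth_continuous sf.
have cpsi := smooth_continuous spsi.
have [Mf fM] := continuous_support_bounded cf f0.
have [Mf' f'M] := continuous_support_bounded cf' (derive_support df f0).
have [Mpsi psiM] := continuous_support_bounded cpsi psi0.
by rewrite (Rintegral_swap_tensor u0i cf' cpsi f'M psiM) (Rintegral_swap_tensor g0i cf cpsi fM psiM).
Qed.

End weak.
End test_functions.

(** * Sobolev graphs *)

Section no_graph.
Variables (R : realType) (X : Type) (d : X -> X -> R) (S : set X).
Hypotheses (d0 : forall x y, 0 <= d x y) (Soo : (hausdorff d 2 S < +oo)%E).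
Notation mu := (@lebesgue_measure R).

Lemma bounded_continuous_itv_restrict (a b M : R) (f : R -> R) :
  (forall s, a < s < b -> {for s, continuous f}) ->
  (forall s, a < s < b -> `|f s| <= M) -> 0 <= M ->
  measurable_fun setT (f \_ `]a, b[) /\ forall s, `|(f \_ `]a, b[) s| <= M.
Proof.
move=> cf fM M0; split.
  apply: (@proj1 _ _ (@measurable_restrictT _ _ _ _ `]a, b[%classic f _)).
    exact: measurable_itv.
  apply: open_continuous_measurable_fun; first exact: interval_open.
  by move=> s; rewrite inE/= in_itv/=; exact: cf.
move=> s; rewrite patchE; case: ifPn => [|_]; last by rewrite normr0.
by rewrite inE/= in_itv/=; exact: fM.
Qed.

(* The graph z = u(s, t) sits in X through P; V and V - t m(s) are functions of
   (s, t, z) which oscillate by O(d^2) along the lines t = const and s = const. *)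
Lemma no_sobolev_graph (D : set (R * R)) (u : R * R -> R) (a b c e B : R)
    (N : set (R * R)) (P : R -> R -> R -> X) (al be m : R -> R) :
  W11loc D u -> `[a, b] `*` `[c, e] `<=` D -> a < b -> c < e ->
  (leb2 R).-negligible N ->
  (forall s t, a < s < b -> c < t < e -> ~ N (s, t) -> S (P s t (u (s, t)))) ->
  (forall s, a < s < b -> [/\ {for s, continuous al}, {for s, continuous be} &
    {for s, continuous m}]) ->
  (forall s, a < s < b -> [/\ `|al s| <= B, `|be s| <= B & `|m s| <= B]) ->
  (forall s s', a < s < b -> a < s' < b ->
    `|al s - al s'| <= B * `|s - s'| /\ `|be s - be s'| <= B * `|s - s'|) ->
  (forall s s', a < s < b -> a < s' < b -> m s = m s' -> s = s') ->
  (forall K : R, exists2 C, 0 <= C & forall s t z s' t' z' r,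
    a < s < b -> a < s' < b -> c < t < e -> c < t' < e -> `|z| <= K -> `|z'| <= K ->
    0 <= r <= 1 -> d (P s t z) (P s' t' z') <= r ->
    [/\ `|t - t'| <= C * r, `|s - s'| <= C * r,
     t = t' -> `|(al s * z + be s * t) - (al s' * z' + be s' * t)| <= C * r ^+ 2 &
     s = s' -> `|(al s * z + be s * t - t * m s) - (al s * z' + be s * t' - t' * m s)|
       <= C * r ^+ 2]) ->
  False.
Proof.
move=> [uL [[g1 g1L wd1] [g2 g2L wd2]]] QD ab ce nN PS cont bnd lip minj geom.
have [u0 u0i [u00 uu0]] := L1loc_rect uL QD.
have [h1 h1i [h10 gh1]] := L1loc_rect g1L QD.
have [h2 h2i [h20 gh2]] := L1loc_rect g2L QD.
set Q : set (R * R) := `[a, b] `*` `[c, e] in QD u00 uu0 h10 gh1 h20 gh2.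
have B0 : 0 <= B.
  have abm : a < (a + b) / 2 < b by apply/andP; split; lra.
  by have [/(le_trans (normr_ge0 _))] := bnd _ abm.
have QE s t : a < s < b -> c < t < e -> Q (s, t).
  move=> /andP[? ?] /andP[? ?]; rewrite /Q /= !in_itv/=.
  by split; apply/andP; split; exact: ltW.
(* From here on [u0] replaces [u]; the points of the rectangle where they differ join the
   exceptional set. *)
pose N' := N `|` ~` [set p | Q p -> u p = u0 p].
have nN' : (leb2 R).-negligible N' by apply: negligibleU => //; exact: uu0.
have PS' s t : a < s < b -> c < t < e -> ~ N' (s, t) -> S (P s t (u0 (s, t))).
  move=> abs cet /not_orP[Ns /contrapT uE]; rewrite -uE; first exact: PS.
  exact: QE.
have T1 := weak_derivative_tensor1 QD u00 h10 uu0 gh1 wd1.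
have T2 := weak_derivative_tensor2 QD u00 h20 uu0 gh2 u0i h2i wd2.
have acl1 := weak_acl ab u0i h1i _ T1.
have acl2 := weak_acl ce (integrable_swap u0i) (integrable_swap h2i) _ T2.
pose V s t z := al s * z + be s * t.
pose ce_ := `|c| + `|e|.
have tce t : c < t < e -> `|t| <= ce_ by exact: normr_itv_le.
(* All variables may move here, so that the estimate serves for both families of lines. *)
have lipV K : exists2 C, 0 <= C & forall s t z s' t' z',
    a < s < b -> a < s' < b -> c < t < e -> c < t' < e -> `|z| <= K -> `|z'| <= K ->
    `|V s t z - V s' t' z'| <= C * (`|s - s'| + (`|t - t'| + `|z - z'|)).
  exists (B * (1 + `|K| + ce_)).
    by rewrite mulr_ge0// addr_ge0 ?addr_ge0.
  move=> s t z s' t' z' abs abs' cet cet' zK zK'.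
  have -> : V s t z - V s' t' z' = al s * (z - z') + (al s - al s') * z' +
      (be s * (t - t') + (be s - be s') * t') by rewrite /V; ring.
  have [Ba Bb _] := bnd s abs; have [la lb] := lip s s' abs abs'.
  have e1 : `|al s * (z - z')| <= B * `|z - z'| by rewrite normrM ler_wpM2r.
  have e2 : `|be s * (t - t')| <= B * `|t - t'| by rewrite normrM ler_wpM2r.
  have e3 : `|(al s - al s') * z'| <= B * `|s - s'| * `|K|.
    by rewrite normrM ler_pM// (le_trans zK')// ler_norm.
  have e4 : `|(be s - be s') * t'| <= B * `|s - s'| * ce_.
    by rewrite normrM ler_pM// tce.
  apply: le_trans (ler_normD _ _) _.
  apply: le_trans (lerD (ler_normD _ _) (ler_normD _ _)) _.
  apply: le_trans (lerD (lerD e1 e3) (lerD e2 e4)) _.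
  have ce0 : 0 <= ce_ by rewrite addr_ge0.
  have := normr_ge0 K; have := normr_ge0 (s - s'); have := normr_ge0 (t - t').
  have := normr_ge0 (z - z').
  move: `|K| `|s - s'| `|t - t'| `|z - z'| => k x y w w0 y0 x0 k0.
  rewrite -subr_ge0.
  have -> : B * (1 + k + ce_) * (x + (y + w)) - (B * w + B * x * k + (B * y + B * x * ce_)) =
    B * (x + (k + ce_) * (y + w)) by ring.
  by rewrite !(mulr_ge0, addr_ge0).
have H1 : {ae mu, forall t, c < t < e ->
    exists k, {ae mu, forall s, a < s < b -> V s t (u0 (s, t)) = k}}.
  apply: (line_constant d0 Soo ab (acl1 _) nN' PS') => [p Hp|K|K].
  - by apply: h10 => -[/=]; rewrite in_itv/= => abp; rewrite abp in Hp.
  - have [C C0 HC] := geom K; exists C => // s t z s' t' z' r abs abs' cet cet' zK zK' r01 dr.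
    by have [] := HC _ _ _ _ _ _ _ abs abs' cet cet' zK zK' r01 dr.
  - have [C C0 HC] := lipV K; exists C => // s t z s' z' abs abs' cet zK zK'.
    by have := HC _ _ _ _ _ _ abs abs' cet cet zK zK'; rewrite subrr normr0 add0r.
have H2 : {ae mu, forall s, a < s < b ->
    exists k, {ae mu, forall t, c < t < e -> V s t (u0 (s, t)) - t * m s = k}}.
  (* The second family of lines is the first one with the two parameters exchanged. *)
  apply: (@line_constant _ _ d S d0 Soo c e a b (fun p => u0 (p.2, p.1)) _
    (fun t s z => P s t z) (fun t s z => V s t z - t * m s) ce (acl2 _)
    (negligible_swap nN')) => [p Hp|t s cet abs|K|K].
  - by apply: h20 => -[/= _]; rewrite in_itv/= => cep; rewrite cep in Hp.
  - exact: PS'.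
  - have [C C0 HC] := geom K; exists C => // t s z t' s' z' r cet cet' abs abs' zK zK' r01 dr.
    have [_ ss _ H] := HC _ _ _ _ _ _ _ abs abs' cet cet' zK zK' r01 dr.
    by split => // ss'; exact: H.
  - have [C C0 HC] := lipV K; exists (C + B); first by rewrite addr_ge0.
    move=> t s z t' z' cet cet' abs zK zK'.
    have := HC _ _ _ _ _ _ abs abs cet cet' zK zK'; rewrite subrr normr0 add0r => Hv.
    have -> : V s t z - t * m s - (V s t' z' - t' * m s) =
        (V s t z - V s t' z') - m s * (t - t') by ring.
    apply: le_trans (ler_normB _ _) _.
    have [_ _ Bm] := bnd s abs.
    have Hm : `|m s * (t - t')| <= B * `|t - t'| by rewrite normrM ler_wpM2r.
    apply: le_trans (lerD Hv Hm) _; rewrite mulrDl lerD2l ler_wpM2l// lerDl.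
    exact: normr_ge0.
have [mal alB] := bounded_continuous_itv_restrict
  (fun s abs => let: And3 H _ _ := cont s abs in H)
  (fun s abs => let: And3 H _ _ := bnd s abs in H) B0.
have [mbe beB] := bounded_continuous_itv_restrict
  (fun s abs => let: And3 _ H _ := cont s abs in H)
  (fun s abs => let: And3 _ H _ := bnd s abs in H) B0.
set al0 := al \_ _ in mal alB; set be0 := be \_ _ in mbe beB.
have rE (f : R -> R) x y s : x < s < y -> (f \_ `]x, y[) s = f s.
  by move=> xys; rewrite patchE mem_set//= in_itv.
have r0 (f : R -> R) x y s : ~~ (x < s < y) -> (f \_ `]x, y[) s = 0.
  by move=> xys; rewrite patchE memNset//= in_itv/=; exact/negP.
pose tau := (id : R -> R) \_ `]c, e[.
have [mtau tauB] : measurable_fun setT tau /\ forall t, `|tau t| <= ce_.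
  apply: (@bounded_continuous_itv_restrict c e ce_ id) => [t _|t|].
  - exact: cvg_id.
  - exact: tce.
  - by rewrite addr_ge0.
have itau := integrable_itv_support mtau tauB (@r0 id c e).
have ibe := integrable_itv_support mbe beB (@r0 be a b).
(* This is [V] along [u0], with coefficients cut off so that it is integrable on the plane. *)
pose v (p : R * R) := al0 p.1 * u0 p + be0 p.1 * tau p.2.
have vi : (leb2 R).-integrable setT (EFin \o v).
  apply: integrable_addr => //; last exact: (integrable_tensor ibe itau).
  apply: (le_integrable_scale (M := B) u0i); last by move=> p; rewrite normrM ler_wpM2r.
  apply: measurable_funM; first exact: (measurableT_comp mal measurable_fst).
  by apply/measurable_EFinP; exact: measurable_int u0i.
have vV s t : a < s < b -> c < t < e -> v (s, t) = V s t (u0 (s, t)).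
  by move=> abs cet; rewrite /v /V /al0 /be0 /tau /= !rE.
apply: (@lines_contradiction R a b c e B v m ab ce vi).
- apply: open_continuous_measurable_fun; first exact: interval_open.
  by move=> s; rewrite inE/= in_itv/= => /cont[].
- by move=> s /bnd[].
- exact: minj.
- apply: filterS H1; first exact: (ae_filter_ringOfSetsType mu).
  move=> t Ht cet; have [k Hk] := Ht cet; exists k.
  apply: filterS Hk; first exact: (ae_filter_ringOfSetsType mu).
  by move=> s Hs abs; rewrite vV// Hs.
- apply: filterS H2; first exact: (ae_filter_ringOfSetsType mu).
  move=> s Hs abs; have [k Hk] := Hs abs; exists k.
  apply: filterS Hk; first exact: (ae_filter_ringOfSetsType mu).
  by move=> t Ht cet; rewrite vV// Ht.
Qed.

End no_graph.

(** * The three kinds of graphs *)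

Section graphs.
Variable R : realType.

Lemma edist3_ge (x y : R * R * R) :
  [/\ `|x.1.1 - y.1.1| <= edist3 x y, `|x.1.2 - y.1.2| <= edist3 x y &
      `|x.2 - y.2| <= edist3 x y].
Proof.
have key (p q : R) : 0 <= q -> `|p| <= Num.sqrt (p ^+ 2 + q).
  by move=> q0; rewrite -sqrtr_sqr ler_sqrt ?addr_ge0 ?sqr_ge0// lerDl.
rewrite /edist3; split.
- by rewrite -addrA; apply: key; rewrite addr_ge0 ?sqr_ge0.
- by rewrite -addrA addrCA; apply: key; rewrite addr_ge0 ?sqr_ge0.
- by rewrite [X in Num.sqrt X]addrC; apply: key; rewrite addr_ge0 ?sqr_ge0.
Qed.

(** The rectangle keeps a distance [sg] from [s = 0], on one side of it: the graphs of x and of y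
    lead to a division by [s], and the injectivity of [s ^+ 2] needs a fixed sign. *)
Lemma open_rect (D : set (R * R)) : open D -> D !=set0 ->
  exists a b c e sg : R,
    [/\ a < b, c < e, 0 < sg, `[a, b] `*` `[c, e] `<=` D &
        (forall s, a < s < b -> sg <= s) \/ (forall s, a < s < b -> s <= - sg)].
Proof.
move=> oD [[s0 t0] Dp]; have : nbhs (s0, t0) D by exact: open_nbhs_nbhs.
move=> /nbhs_ballP[r /= r0 rD].
have sub (s t : R) : `|s0 - s| < r -> `|t0 - t| < r -> D (s, t).
  by move=> sr tr; apply: rD; split.
have [s00|s00] := leP 0 s0.
- exists (s0 + r / 4), (s0 + r / 2), (t0 - r / 2), (t0 + r / 2), (r / 4).
  split; [lra|lra|lra| |by left => s /andP[? ?]; lra].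
  move=> [s t] /=; rewrite !in_itv/= => -[/andP[? ?] /andP[? ?]].
  by apply: sub; rewrite ltr_norml; apply/andP; split; lra.
- exists (s0 - r / 2), (s0 - r / 4), (t0 - r / 2), (t0 + r / 2), (r / 4).
  split; [lra|lra|lra| |by right => s /andP[? ?]; lra].
  move=> [s t] /=; rewrite !in_itv/= => -[/andP[? ?] /andP[? ?]].
  by apply: sub; rewrite ltr_norml; apply/andP; split; lra.
Qed.

(** Turns the contact estimate along [t = const] into an oscillation bound for [u / s]. *)
Lemma inv_cross (sg s s' z z' y : R) : 0 < sg -> sg <= `|s| -> sg <= `|s'| ->
  `|z * s' - s * z'| <= y -> `|s^-1 * z - s'^-1 * z'| <= y / sg ^+ 2.
Proof.
move=> sg0 ss ss' H.
have s0 : s != 0 by rewrite -normr_gt0 (lt_le_trans sg0).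
have s'0 : s' != 0 by rewrite -normr_gt0 (lt_le_trans sg0).
have -> : s^-1 * z - s'^-1 * z' = (z * s' - s * z') / (s * s').
  by field; rewrite s0 s'0.
rewrite normrM ler_pM// normfV lef_pV2 ?posrE ?normr_gt0 ?mulf_neq0 ?exprn_gt0//.
by rewrite normrM expr2 ler_pM// ltW.
Qed.

Section cases.
Variables (d : R * R * R -> R * R * R -> R) (S : set (R * R * R)).
Hypotheses (hd : homogeneous_distance d) (Soo : (hausdorff d 2 S < +oo)%E).
Variables (D : set (R * R)) (u : R * R -> R).
Hypotheses (oD : open D) (D0 : D !=set0) (uW : W11loc D u).

(** Serves for the graphs of x and of y; [eps] is the sign of the cross term in the group law, which
    changes when the horizontal coordinates are exchanged. Along [s = const] the controlled function
    is [t + eps * s * z]; divided by [eps * s ^+ 2] it becomes [z / s - t * m s] with the [m] chosen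
    below. *)
Lemma no_sobolev_graph_inv (N : set (R * R)) (P : R -> R -> R -> R * R * R)
    (eps : R) : `|eps| = 1 ->
  (leb2 R).-negligible N ->
  (forall s t, D (s, t) -> ~ N (s, t) -> S (P s t (u (s, t)))) ->
  (exists2 C, 0 < C & forall s t z s' t' z' r, d (P s t z) (P s' t' z') <= r ->
    [/\ `|s - s'| <= C * r, `|z - z'| <= C * r &
        `|t' - t - eps * (z * s' - s * z')| <= C * r ^+ 2]) ->
  False.
Proof.
move=> eps1 nN PS [C C0 HC].
have [a [b [c [e [sg [ab ce sg0 QD sgn]]]]]] := open_rect oD D0.
have sgs s : a < s < b -> sg <= `|s|.
  move=> abs; case: sgn => /(_ s abs) H; first by rewrite (le_trans H)// ler_norm.
  by rewrite -normrN (le_trans _ (ler_norm (- s)))// lerNr.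
have inj s s' : a < s < b -> a < s' < b -> s ^+ 2 = s' ^+ 2 -> s = s'.
  move=> abs abs' /eqP; rewrite eqf_sqr => /orP[/eqP//|/eqP ss'].
  by case: sgn => sgn; have := sgn s abs; have := sgn s' abs'; lra.
have s0 s : a < s < b -> s != 0.
  by move=> /sgs H; rewrite -normr_gt0 (lt_le_trans sg0).
have e0 : eps != 0 by rewrite -normr_gt0 eps1.
have ee : eps * eps = 1.
  by rewrite -expr2 -[LHS]ger0_norm ?sqr_ge0// normrX eps1 expr1n.
pose al (s : R) := s^-1.
pose m (s : R) := - eps * (s ^+ 2)^-1.
have sg2 : 0 < sg ^+ 2 by rewrite exprn_gt0.
pose B := sg^-1 + (sg ^+ 2)^-1.
have B1 : sg^-1 <= B by rewrite lerDl invr_ge0 ltW.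
have B2 : (sg ^+ 2)^-1 <= B by rewrite lerDr invr_ge0 ltW.
have B0 : 0 <= B by apply: le_trans B1; rewrite invr_ge0 ltW.
have calV s : a < s < b -> {for s, continuous al}.
  by move=> abs; apply: continuousV; [exact: s0|exact: cvg_id].
apply: (@no_sobolev_graph R _ d S (hdist_ge0 hd) Soo D u a b c e B N P al (fun=> 0) m) => //.
- move=> s t /andP[? ?] /andP[? ?]; apply: PS; apply: QD => /=; rewrite !in_itv/=.
  by split; apply/andP; split; exact: ltW.
- move=> s abs; split; [exact: calV|exact: cvg_cst|].
  apply: continuousM; first exact: cvg_cst.
  apply: continuousV; first by rewrite expf_neq0// s0.
  exact: exprn_continuous.
- move=> s abs; have ss := sgs s abs; split; rewrite ?normr0//.
  + rewrite normfV (le_trans _ B1)// lef_pV2 ?posrE// (lt_le_trans sg0)//.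
  + rewrite normrM normrN eps1 mul1r normfV normrX (le_trans _ B2)// lef_pV2 ?posrE//.
      by rewrite ler_sqr ?nnegrE// ltW.
    by rewrite exprn_gt0// (lt_le_trans sg0).
- move=> s s' abs abs'; split; last by rewrite subrr normr0 mulr_ge0.
  have := @inv_cross sg s s' 1 1 `|s - s'| sg0 (sgs _ abs) (sgs _ abs').
  rewrite !mulr1 mul1r distrC => /(_ (lexx _)) H.
  by rewrite /al (le_trans H)// mulrC ler_wpM2r.
- move=> s s' abs abs' /(mulfI _) H; apply: inj => //; apply: invr_inj.
  by apply: H; rewrite oppr_eq0.
- move=> K; pose B' := `|a| + `|b|.
  have sB s : a < s < b -> `|s| <= B' by exact: normr_itv_le.
  have B'0 : 0 <= B' by rewrite addr_ge0.
  (* The first summand serves for the linear bounds, the second for the quadratic ones after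
     division by quantities of modulus at least [sg ^+ 2]. *)
  exists (C * (1 + `|K| + B') + C / sg ^+ 2).
    by rewrite addr_ge0 ?mulr_ge0 ?addr_ge0 ?invr_ge0 ?(ltW C0) ?(ltW sg2).
  move=> s t z s' t' z' r abs abs' cet cet' zK zK' /andP[r0 r1] dr.
  have [h1 h2 h3] := HC _ _ _ _ _ _ _ dr.
  have Csg : 0 <= C / sg ^+ 2 by apply: mulr_ge0; rewrite ?invr_ge0; exact: ltW.
  have CK : C <= C * (1 + `|K| + B').
    by rewrite ler_peMr ?(ltW C0)// -addrA lerDl addr_ge0.
  have C2 : C * r <= (C * (1 + `|K| + B') + C / sg ^+ 2) * r.
    by rewrite ler_wpM2r// (le_trans CK)// lerDl.
  have C3 : C * r ^+ 2 / sg ^+ 2 <= (C * (1 + `|K| + B') + C / sg ^+ 2) * r ^+ 2.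
    by rewrite mulrAC ler_wpM2r ?sqr_ge0// lerDr (le_trans _ CK)// ltW.
  split.
  (* Here [t] is the vertical coordinate, controlled only through the contact expression: its cross
     term is linear in [r], and [r ^+ 2 <= r] because [r <= 1]. *)
  + have cr : `|eps * (z * s' - s * z')| <= (`|K| + B') * (C * r).
      rewrite normrM eps1 mul1r.
      have -> : z * s' - s * z' = z * (s' - s) + s * (z - z') by ring.
      apply: le_trans (ler_normD _ _) _; rewrite [leRHS]mulrDl !normrM.
      apply: lerD; apply: ler_pM => //; [|by rewrite distrC|exact: sB].
      by rewrite (le_trans zK)// ler_norm.
    have tt : `|t - t'| <= C * r ^+ 2 + (`|K| + B') * (C * r).
      rewrite distrC -[t' - t](subrK (eps * (z * s' - s * z'))).
      by apply: le_trans (ler_normD _ _) (lerD h3 cr).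
    apply: le_trans tt _.
    have rr : C * r ^+ 2 <= C * r by rewrite ler_wpM2l ?(ltW C0)// expr2 ler_piMl.
    apply: le_trans (lerD rr (lexx _)) _.
    have -> : (C * (1 + `|K| + B') + C / sg ^+ 2) * r =
      C * r + (`|K| + B') * (C * r) + C / sg ^+ 2 * r by ring.
    by rewrite lerDl mulr_ge0.
  + exact: le_trans h1 C2.
  + move=> tt'; rewrite !mul0r !addr0 /al; apply: le_trans C3.
    apply: inv_cross => //; [exact: sgs|exact: sgs|].
    by move: h3; rewrite tt' subrr sub0r normrN normrM eps1 mul1r.
  + move=> ss'; rewrite !mul0r !addr0; apply: le_trans C3.
    have -> : al s * z - t * m s - (al s * z' - t' * m s) =
        - eps * (t' - t - eps * (z * s - s * z')) / s ^+ 2.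
      rewrite /al /m.
      have -> : - eps * (t' - t - eps * (z * s - s * z')) =
         - eps * (t' - t) + (eps * eps) * (z * s - s * z') by ring.
      by rewrite ee; field; exact: s0.
    move: h3; rewrite -ss' => h3.
    rewrite normrM normrM normrN eps1 mul1r normfV normrX ler_pM//.
    have := sgs s abs => ss; rewrite lef_pV2 ?posrE//.
      by rewrite ler_sqr ?nnegrE// ltW.
    by rewrite exprn_gt0// (lt_le_trans sg0).
Qed.

Lemma no_sobolev_graph_vert (N : set (R * R)) :
  (leb2 R).-negligible N ->
  (forall s t, D (s, t) -> ~ N (s, t) -> S (s, t, u (s, t))) -> False.
Proof.
move=> nN PS; have [C C0 HC] := hdist_coord_bounds hd.
have [a [b [c [e [sg [ab ce sg0 QD _]]]]]] := open_rect oD D0.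
pose B' := `|a| + `|b|.
have sB s : a < s < b -> `|s| <= B' by exact: normr_itv_le.
have B'0 : 0 <= B' by rewrite addr_ge0.
(* The functions controlled along the two families differ by [2 * s * t], whence [m]; the constant
   [1 + 2 * B'] bounds [1], [s] and [2 * s] at once. *)
apply: (@no_sobolev_graph R _ d S (hdist_ge0 hd) Soo D u a b c e (1 + 2 * B') N
  (fun s t z => (s, t, z)) (fun=> 1) id (fun s => 2 * s)) => //.
- move=> s t /andP[? ?] /andP[? ?]; apply: PS; apply: QD => /=; rewrite !in_itv/=.
  by split; apply/andP; split; exact: ltW.
- move=> s abs; split; [exact: cvg_cst|exact: cvg_id|].
  by apply: continuousM; [exact: cvg_cst|exact: cvg_id].
- move=> s /sB H; rewrite normr1 normrM [`|2|]ger0_norm//; split; lra.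
- move=> s s' _ _; rewrite subrr normr0; split.
    by rewrite mulr_ge0// addr_ge0// mulr_ge0.
  by rewrite ler_peMl// lerDl mulr_ge0.
- by move=> s s' _ _; apply: mulfI.
- move=> K; exists C; first exact: ltW.
  move=> s t z s' t' z' r abs abs' cet cet' zK zK' /andP[r0 r1] dr.
  have [/= h1 h2 h3] := HC _ _ _ dr; split => //.
  + move=> tt'; rewrite distrC; move: h3; rewrite -tt'.
    by congr (`|_| <= _); ring.
  + move=> ss'; rewrite distrC; move: h3; rewrite -ss'.
    by congr (`|_| <= _); ring.
Qed.

End cases.
End graphs.

Theorem corollary1 (R : realType) (d : R * R * R -> R * R * R -> R)
    (hd : homogeneous_distance d) :
  ~ exists Sigma : set (R * R * R),
      sobolev_surface Sigma /\ (0 < hausdorff d 2 Sigma < +oo)%E.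
Proof.
move=> [S [[_ [F [_ [G FG] FS Z0]]] /andP[_ Soo]]].
have [D [u [oD D0 uW _ Gu]]] := FS G FG.
set Z := _ `+` _ in Z0.
have GZ x : G x -> ~ S x -> Z x.
  by move=> Gx Sx; right; split => //; exists G.
(* Here [f] maps a point of the graph to its parameters; a point of [G] outside [S] lies in [Z], and
   the projection of [Z] is null. *)
have proj (f : R * R * R -> R * R) (P : R -> R -> R -> R * R * R) :
    (forall x y, `|(f x).1 - (f y).1| <= edist3 x y) ->
    (forall x y, `|(f x).2 - (f y).2| <= edist3 x y) ->
    (forall s t z, f (P s t z) = (s, t)) ->
    (forall s t, D (s, t) -> G (P s t (u (s, t)))) ->
    exists2 N, (leb2 R).-negligible N &
      forall s t, D (s, t) -> ~ N (s, t) -> S (P s t (u (s, t))).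
  move=> f1 f2 fP DG; exists (f @` Z); first exact: negligible_projection.
  move=> s t Dst nZ; apply: contrapT => nS; apply: nZ.
  by exists (P s t (u (s, t))) => //; apply: GZ => //; exact: DG.
have [C C0 HC] := hdist_coord_bounds hd.
case: Gu => GE.
- have [|||s t Dst|N nN NS] := @proj (fun x => (x.1.2, x.2)) (fun s t z => (z, s, t)).
  + by move=> x y; case: (edist3_ge x y).
  + by move=> x y; case: (edist3_ge x y).
  + by [].
  + by rewrite GE; exists (s, t).
  apply: (@no_sobolev_graph_inv R d S hd Soo D u oD D0 uW N (fun s t z => (z, s, t)) 1 _ nN NS); first exact: normr1.
  exists C => // s t z s' t' z' r /HC[/= h1 h2 h3]; split => //.
  by rewrite mul1r.
- have [|||s t Dst|N nN NS] := @proj (fun x => (x.1.1, x.2)) (fun s t z => (s, z, t)).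
  + by move=> x y; case: (edist3_ge x y).
  + by move=> x y; case: (edist3_ge x y).
  + by [].
  + by rewrite GE; exists (s, t).
  apply: (@no_sobolev_graph_inv R d S hd Soo D u oD D0 uW N (fun s t z => (s, z, t)) (- 1) _ nN NS).
    by rewrite normrN1.
  exists C => // s t z s' t' z' r /HC[/= h1 h2 h3]; split => //.
  by move: h3; congr (`|_| <= _); ring.
- have [|||s t Dst|N nN NS] := @proj (fun x => x.1) (fun s t z => (s, t, z)).
  + by move=> x y; case: (edist3_ge x y).
  + by move=> x y; case: (edist3_ge x y).
  + by [].
  + by rewrite GE; exists (s, t).
  exact: (@no_sobolev_graph_vert R d S hd Soo D u oD D0 uW N nN NS).
Qed.
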